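(* Let $\phi$ be a branching mechanism with $\phi'(\infty)=\infty$ and let $\mathbf{N}_0$ be the excursion law of the CB-process with branching mechanism $\phi$. Let $z\ge 0$ and let $N_z=\sum_{i=1}^\infty\delta_{w_i}$ be a Poisson random measure on $D[0,\infty)$ with intensity $z\mathbf{N}_0(dw)$. Let $X_0^z=z$ and for $t>0$ let $$X_t^z=\int_{D[0,\infty)}w(t)\,N_z(dw)=\sum_{i=1}^\infty w_i(t).$$ For $t\ge 0$ let $\mathcal{G}_t^z$ be the $\sigma$-algebra generated by the collection of random variables $\{N_z(A):A\in\mathcal{A}_t\}$. Then $\{(X_t^z,\mathcal{G}_t^z):t\ge 0\}$ is a CB-process with branching mechanism $\phi$.
   Context: A branching mechanism is a function $\phi(z)=bz+cz^2+\int_{(0,\infty)}(e^{-zu}-1+zu)\,m(du)$, $z\ge 0$, with $b\in\mathbb{R}$, $c\ge 0$ and $m$ a $\sigma$-finite measure on $(0,\infty)$ with $\int_{(0,\infty)}(u\wedge u^2)\,m(du)<\infty$; $\phi'(\infty)=\lim_{z\to\infty}\phi'(z)$. For $\lambda\ge 0$, $t\mapsto v_t(\lambda)$ is the unique nonnegative solution of $v_t(\lambda)=\lambda-\int_0^t\phi(v_s(\lambda))\,ds$. $(Q_t)_{t\ge 0}$ is the (Feller) transition semigroup on $[0,\infty)$ given by $\int_{[0,\infty)}e^{-\lambda y}Q_t(x,dy)=e^{-xv_t(\lambda)}$, and $(Q_t^\circ)_{t\ge 0}$ is its restriction to $(0,\infty)$. A pair $\{(X_t,\mathcal{G}_t):t\ge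 0\}$ is a CB-process with branching mechanism $\phi$ if $X$ is a $[0,\infty)$-valued Markov process relative to $(\mathcal{G}_t)$ with transition semigroup $(Q_t)_{t\ge 0}$. $D[0,\infty)$ is the space of nonnegative càdlàg paths $w$ on $[0,\infty)$; $\mathcal{A}=\sigma(\{w(s):0\le s<\infty\})$, $\mathcal{A}_t=\sigma(\{w(s):0\le s\le t\})$; $\tau_0(w)=\inf\{s>0:w(s)=0\}$; $D_1[0,\infty)$ is the set of $w\in D[0,\infty)$ with $w(0)=0$ and $w(t)=0$ for $t\ge\tau_0(w)$. When $\phi'(\infty)=\infty$ there are unique $\sigma$-finite measures $(l_t)_{t>0}$ on $(0,\infty)$ with $v_t(\lambda)=\int_{(0,\infty)}(1-e^{-\lambda u})\,l_t(du)$ for $t>0,\lambda\ge0$, and the excursion law $\mathbf{N}_0$ is the $\sigma$-finite measure on $(D[0,\infty),\mathcal{A})$ supported by $D_1[0,\infty)$ (not charging the zero path) such that for $0<t_1<\cdots<t_n$ and $x_1,\dots,x_n\in(0,\infty)$: $\mathbf{N}_0(w(t_1)\in dx_1,\dots,w(t_n)\in dx_n)=l_{t_1}(dx_1)Q^\circ_{t_2-t_1}(x_1,dx_2)\cdots Q^\circ_{t_n-t_{n-1}}(x_{n-1},dx_n)$. *)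

(* Defs.v *)
From HB Require Import structures.
From mathcomp Require Import all_boot all_order all_algebra.
From mathcomp Require Import all_classical all_reals all_analysis.
From mathcomp Require Import measurable_realfun.

Set Implicit Arguments.
Unset Strict Implicit.
Unset Printing Implicit Defensive.

Import Order.TTheory GRing.Theory Num.Theory.
Import numFieldNormedType.Exports.

Local Open Scope classical_set_scope.
Local Open Scope ring_scope.

(* Conventions. Time and state variables live in [R], and objects indexed by
   t >= 0, t > 0 or x >= 0 are only constrained there. A measure on [0, oo)
   (resp. (0, oo)) is a Borel measure on [R] for which the negative
   (resp. nonpositive) reals are a null set. *)

Section branching_mechanism.
Context {R : realType}.
Implicit Types (phi : R -> R) (v : R -> R -> R).

Definition is_branching_mechanism phi : Prop :=
  exists (b c : R) (m : {sigma_finite_measure set (measurableTypeR R) -> \bar R}),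
  [/\ 0 <= c,
      m [set u : R | u <= 0] = 0%E,
      (\int[m]_(u in `]0%R, +oo[) (Num.min u (u ^+ 2))%:E < +oo)%E
    & forall z : R, 0 <= z ->
        phi z = b * z + c * z ^+ 2
                + \int[m]_(u in `]0, +oo[) (expR (- (z * u)) - 1 + z * u)].

(* [v t lambda] is v_t(lambda). Integrability is required because [Rintegral]
   is total: it rules out spurious solutions. *)
Definition is_cumulant_semigroup phi v : Prop :=
  forall lambda t : R, 0 <= lambda -> 0 <= t ->
  [/\ 0 <= v t lambda,
      lebesgue_measure.-integrable `[0, t] (fun s => (phi (v s lambda))%:E)
    & v t lambda =
        lambda - \int[lebesgue_measure]_(s in `[0, t]) phi (v s lambda)].

End branching_mechanism.

Section transition_semigroup.
Context {R : realType}.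
Local Notation RR := (measurableTypeR R).
Implicit Types (v : R -> R -> R) (Q : R -> R.-pker RR ~> RR).

Definition is_transition_semigroup v Q : Prop :=
  forall t x : R, 0 <= t -> 0 <= x ->
  Q t x [set y : R | y < 0] = 0%E /\
  forall lambda : R, 0 <= lambda ->
    (\int[Q t x]_(y in `[0%R, +oo[) (expR (- (lambda * y)))%:E =
     (expR (- (x * v t lambda)))%:E)%E.

(* the restriction of (Q_t) to (0, oo) *)
Definition Qo Q (t x : R) : {measure set RR -> \bar R} :=
  mrestr (Q t x) (measurable_itv `]0, +oo[).

Definition is_entrance_family v
    (l : R -> {sigma_finite_measure set RR -> \bar R}) : Prop :=
  forall t : R, 0 < t ->
  l t [set u : R | u <= 0] = 0%E /\
  forall lambda : R, 0 <= lambda ->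
    ((v t lambda)%:E =
     \int[l t]_(u in `]0%R, +oo[) (1 - expR (- (lambda * u)))%:E)%E.

End transition_semigroup.

Section path_space.
Context {R : realType}.

(* right-continuous on [0, oo) with left limits on (0, oo) *)
Definition is_cadlag (w : R -> R) : Prop :=
  (forall t : R, 0 <= t -> w s @[s --> t^'+] --> w t) /\
  (forall t : R, 0 < t -> cvg (w s @[s --> t^'-])).

End path_space.

(* D[0, oo). Paths are total functions; the value 0 is imposed at negative
   times so that paths are determined by their values on [0, oo). *)
Record Dpath (R : realType) := MkDpath {
  Dpath_fun :> R -> R;
  Dpath_ge0 : forall t : R, 0 <= t -> 0 <= Dpath_fun t;
  Dpath_cadlag : is_cadlag Dpath_fun;
  Dpath_neg : forall t : R, t < 0 -> Dpath_fun t = 0 }.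

Section zero_path.
Context {R : realType}.

Lemma is_cadlag0 : is_cadlag (fun _ : R => 0 : R).
Proof. by split=> t _; [exact: cvg_cst|exact: is_cvg_cst]. Qed.

Definition zero_path : Dpath R :=
  MkDpath (fun _ _ => lexx 0) is_cadlag0 (fun _ _ => erefl).

End zero_path.

HB.instance Definition _ (R : realType) := gen_eqMixin (Dpath R).
HB.instance Definition _ (R : realType) := gen_choiceMixin (Dpath R).
HB.instance Definition _ (R : realType) := isPointed.Build (Dpath R) zero_path.

(* the sigma-algebra on [T] generated by the maps [f i], [i] in [J] *)
Definition sigma_generators (T I : Type) (d : measure_display)
    (S : measurableType d) (J : set I) (f : I -> T -> S) : set (set T) :=
  \bigcup_(i in J) preimage_set_system setT (f i) measurable.

Definition sigma_generated (T I : Type) (d : measure_display)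
    (S : measurableType d) (J : set I) (f : I -> T -> S) : set (set T) :=
  <<s sigma_generators J f >>.

Section path_sigma_algebra.
Context (R : realType).

Definition Dcoord (s : R) (w : Dpath R) : measurableTypeR R := w s.

(* the sigma-algebra A of D[0, oo) is [sigma_generated `[0, +oo[ Dcoord] *)
Local Notation G := (sigma_generators `[0, +oo[ Dcoord).

HB.instance Definition _ := @isMeasurable.Build (sigma_display G) (Dpath R)
  (sigma_generated `[0, +oo[ Dcoord) (@sigma_algebra0 _ setT G)
  (@sigma_algebraC _ G) (@sigma_algebra_bigcup _ setT G).

(* the sigma-algebra A_t *)
Definition Dpast (t : R) : set (set (Dpath R)) :=
  sigma_generated `[0, t] Dcoord.

(* tau_0, equal to +oo when the path does not vanish on (0, oo) *)
Definition tau0 (w : Dpath R) : \bar R :=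
  ereal_inf [set s%:E | s in [set s : R | 0 < s /\ w s = 0]].

Definition D1 : set (Dpath R) :=
  [set w : Dpath R | w 0 = 0 /\ forall t : R, (tau0 w <= t%:E)%E -> w t = 0].

End path_sigma_algebra.

Section excursion_law.
Context {R : realType}.
Local Notation RR := (measurableTypeR R).

(* [Qo_chain Q t B n i x] is the iterated integral
   Qo_{t_{i+1} - t_i}(x, dx_{i+1}) ... Qo_{t_{i+n} - t_{i+n-1}}(x_{i+n-1}, dx_{i+n})
   over x_{i+1} in B_{i+1}, ..., x_{i+n} in B_{i+n}. *)
Fixpoint Qo_chain (Q : R -> R.-pker RR ~> RR) (t : nat -> R) (B : nat -> set RR)
    (n i : nat) (x : R) : \bar R :=
  if n is n'.+1 then
    (\int[Qo Q (t i.+1 - t i)%R x]_(y in B i.+1) Qo_chain Q t B n' i.+1 y)%E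
  else 1%E.

(* The finite-dimensional formula is stated on measurable rectangles, with
   time points t 0 < ... < t n. Since [D1] need not belong to the
   sigma-algebra of the path space, "supported by [D1]" means that the
   complement of [D1] is contained in a measurable null set. *)
Definition is_excursion_law (phi : R -> R)
    (N0 : {sigma_finite_measure set (Dpath R) -> \bar R}) : Prop :=
  exists (v : R -> R -> R) (Q : R -> R.-pker RR ~> RR)
         (l : R -> {sigma_finite_measure set RR -> \bar R}),
  [/\ is_cumulant_semigroup phi v,
      is_transition_semigroup v Q
    & is_entrance_family v l] /\
  [/\ N0.-negligible (~` D1 (R:=R)),
      N0 [set zero_path] = 0%E
    & forall (n : nat) (t : nat -> R) (B : nat -> set RR),
      0 < t 0%N ->
      (forall i, (i < n)%N -> t i < t i.+1) ->
      (forall i, (i <= n)%N -> measurable (B i) /\ B i `<=` `]0, +oo[) ->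
      N0 [set w : Dpath R | forall i, (i <= n)%N -> B i (w (t i))] =
      (\int[l (t 0%N)]_(x in B 0%N) Qo_chain Q t B n 0%N x)%E].

End excursion_law.

Section processes.
Context {R : realType} {d : measure_display} {Omega : measurableType d}.
Local Notation RR := (measurableTypeR R).
Implicit Types (P : probability Omega R) (G : R -> set (set Omega))
  (X : R -> Omega -> R).

Definition is_filtration G : Prop :=
  (forall t : R, 0 <= t -> sigma_algebra setT (G t) /\ G t `<=` measurable) /\
  (forall s t : R, 0 <= s -> s <= t -> G s `<=` G t).

(* [Y] is a version of the conditional probability P(E | F) *)
Definition is_cond_prob P (F : set (set Omega)) (E : set Omega)
    (Y : Omega -> \bar R) : Prop :=
  (forall B : set (\bar R), measurable B -> F (Y @^-1` B)) /\
  (forall A, F A -> (\int[P]_(o in A) Y o = P (A `&` E))%E).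

(* [0, oo)-valued Markov process relative to (G_t) with transitions (Q_t) *)
Definition is_markov_process P (Q : R -> R.-pker RR ~> RR) G X : Prop :=
  [/\ is_filtration G,
      forall t : R, 0 <= t ->
        (forall o, 0 <= X t o) /\
        (forall B : set RR, measurable B -> G t (X t @^-1` B))
    & forall (r t : R) (B : set RR), 0 <= r -> 0 <= t -> measurable B ->
        is_cond_prob P (G r) (X (r + t) @^-1` B) (fun o => Q t (X r o) B)].

Definition is_CB_process P (phi : R -> R) G X : Prop :=
  exists (v : R -> R -> R) (Q : R -> R.-pker RR ~> RR),
  [/\ is_cumulant_semigroup phi v,
      is_transition_semigroup v Q
    & is_markov_process P Q G X].

End processes.

Section poisson_random_measure.
Context {R : realType} {d d' : measure_display}
  {Omega : measurableType d} {E : measurableType d'}.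
Implicit Types (P : probability Omega R) (N : R.-ker Omega ~> E).

(* A random measure is a kernel from [Omega] to [E]. The second argument
   of the library's [poisson_prob] is not used by its definition. *)
Definition is_poisson_random_measure P N
    (mu : {measure set E -> \bar R}) : Prop :=
  (forall A, measurable A -> (mu A < +oo)%E ->
     forall k : nat,
     P [set o | N o A = k%:R%:E] = poisson_prob (fine (mu A)) k [set k]) /\
  (forall (n : nat) (A : 'I_n -> set E),
     (forall i, measurable (A i) /\ (mu (A i) < +oo)%E) ->
     trivIset setT A ->
     forall B : 'I_n -> set (\bar R), (forall i, measurable (B i)) ->
     P [set o | forall i, B i (N o (A i))] =
     (\prod_(i < n) P [set o | B i (N o (A i))])%E).

End poisson_random_measure.

Section excursion_sum.
Context {R : realType} {d : measure_display} {Omega : measurableType d}.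
Implicit Types N : R.-ker Omega ~> (Dpath R).

(* [J o] is the (at most countable, possibly finite or empty) index set of the
   atoms of [N o]; no atoms are present when the intensity is zero. *)
Definition is_atomic_sum N (J : Omega -> set nat)
    (w : Omega -> nat -> Dpath R) : Prop :=
  forall o (A : set (Dpath R)), measurable A ->
    N o A = \esum_(i in J o) \d_(w o i) A.

(* X_t^z, which may be +oo on a null set *)
Definition excursion_sum (z : R) N (t : R) (o : Omega) : \bar R :=
  if 0 < t then (\int[N o]_w (Dcoord t w)%:E)%E else z%:E.

(* the sigma-algebra G_t^z *)
Definition excursion_filtration N (t : R) : set (set Omega) :=
  sigma_generated (Dpast t) (fun A o => N o A).

End excursion_sum.

(* Main.v *)
Require Import Defs.
From HB Require Import structures.
From mathcomp Require Import all_boot all_order all_algebra.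
From mathcomp Require Import all_classical all_reals all_analysis.
From mathcomp Require Import measurable_realfun.
From mathcomp Require Import ring lra.

(* Let [g] be a nonnegative combination of indicators of sets in A_r. By the
   Laplace functional of the Poisson random measure,
     E exp (- N_z(g) - lambda X_(r+t)) =
       exp (- z N_0(1 - exp (- g - lambda w(r+t)))),
   and 1 - exp (- g - h) = (1 - exp (- g)) + exp (- g) (1 - exp (- h)).
   Under N_0 the path is Markov with the transitions (Q_t) absorbed at 0, so
     N_0(exp (- g) (1 - exp (- lambda w(r+t)))) =
       N_0(exp (- g) (1 - exp (- v_t(lambda) w(r)))),
   and lambda w(r+t) may be replaced by v_t(lambda) w(r) in the expectation.
   Laplace transforms at integers, that is moments of exp (- Y), determine the
   joint law of the N_z(A), A in A_r, and then the conditional law of X_(r+t)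
   given G_r. Moments on [0, 1] determine a finite measure because the functions
   exp (- n (x / rho) ^ (2 n)) are uniform limits of polynomials on [0, 1] and
   converge pointwise there to the indicator of {x < rho}. *)

Set Implicit Arguments.
Unset Strict Implicit.
Unset Printing Implicit Defensive.

Import Order.TTheory GRing.Theory Num.Theory.
Import numFieldNormedType.Exports.

Local Open Scope classical_set_scope.
Local Open Scope ring_scope.

(** * Mixtures and determination of measures *)

(** The definition of a Poisson random measure constrains only sets of finite intensity, whereas A_r
    also contains sets of infinite intensity, whose counts may be +oo. With exp (- oo) = 0 the
    Laplace functional treats both kinds alike, so transforms, rather than counts of disjoint sets,
    carry the argument. Likewise X_t may be +oo on a null set and stays extended-valued until the
    final comparison of laws. Under [N0] the Markov identity has to pass from cylinders to all of
    A_r by a pi-system argument, which asks for finite measures, while [N0] is infinite. The weight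
    1 - exp (- lambda w(r+t)) repairs this: its [N0]-integral is v_(r+t)(lambda). It also vanishes
    on paths that have died by time r+t, about which the finite-dimensional laws on (0, oo) say
    nothing. *)

Section mixture.
Import HBNNSimple.
Local Open Scope ereal_scope.
Context d d' (T : measurableType d) (S : measurableType d') (R : realType).
Variables (m : {measure set T -> \bar R}) (D : T -> R)
  (K : T -> {measure set S -> \bar R}).
Hypotheses (D0 : forall x, (0 <= D x)%R) (mD : measurable_fun setT D)
  (mK : forall B, measurable B -> measurable_fun setT (K ^~ B)).

Let mixture (B : set S) : \bar R := \int[m]_x ((D x)%:E * K x B).

Let mixture0 : mixture set0 = 0.
Proof. by apply: integral0_eq => x _; rewrite measure0 mule0. Qed.

Let mixture_ge0 B : 0 <= mixture B.
Proof. by apply: integral_ge0 => x _; rewrite mule_ge0// lee_fin. Qed.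

Let mDK B : measurable B -> measurable_fun setT (fun x => (D x)%:E * K x B).
Proof.
by move=> mB; apply: emeasurable_funM; [exact/measurable_EFinP|exact: mK].
Qed.

Let mixture_sigma_additive : semi_sigma_additive mixture.
Proof.
move=> F mF tF mUF.
rewrite [X in _ --> X](_ : _ = \sum_(n <oo) mixture (F n)); last first.
  rewrite /mixture -integral_nneseries//.
  - apply: eq_integral => x _; rewrite nneseriesZl//.
    congr *%E; apply/esym/cvg_lim => //.
    exact: (@measure_semi_sigma_additive _ _ _ (K x)).
  - by move=> n; exact: mDK.
  - by move=> n x _; rewrite mule_ge0// lee_fin.
by apply: is_cvg_nneseries => n _ _; exact: mixture_ge0.
Qed.

HB.instance Definition _ := isMeasure.Build _ _ _ mixture
  mixture0 mixture_ge0 mixture_sigma_additive.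

(** Here [m] is an arbitrary measure (both [N0] and [P] will occur) and [K] a mere measurable
    family, so the integral formula is obtained from simple functions by monotone convergence
    instead of a Fubini theorem. *)
Lemma mixture_measure : exists nu : {measure set S -> \bar R},
  (forall B, nu B = \int[m]_x ((D x)%:E * K x B)) /\
  forall f : S -> \bar R, (forall y, 0 <= f y) -> measurable_fun setT f ->
    \int[nu]_y f y = \int[m]_x ((D x)%:E * \int[K x]_y f y).
Proof.
exists mixture; split=> // f f0 mf.
pose g := nnsfun_approx measurableT mf.
have mg n : measurable_fun setT (fun y => (g n y)%:E) by exact/measurable_EFinP.
have g0 n y : 0 <= (g n y)%:E by rewrite lee_fin.
have ndg y a b : (a <= b)%N -> (g a y)%:E <= (g b y)%:E.
  by move=> ab; rewrite lee_fin; exact/lefP/nd_nnsfun_approx.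
have gf y : f y = limn (fun n => (g n y)%:E).
  by apply/esym/cvg_lim => //; exact: cvg_nnsfun_approx.
have intg (mu : {measure set S -> \bar R}) n :
    \int[mu]_y (g n y)%:E = \sum_(r \in range (g n)) r%:E * mu (g n @^-1` [set r]).
  by rewrite integralT_nnsfun sintegralE.
have K0 n r x : 0 <= (D x)%:E * (r%:E * K x (g n @^-1` [set r])).
  by rewrite mule_ge0 ?lee_fin// nnsfun_mulemu_ge0.
transitivity (limn (fun n => \int[mixture]_y (g n y)%:E)).
  rewrite -monotone_convergence//; last by move=> y _ a b; exact: ndg.
  by apply: eq_integral => y _; exact: gf.
have mKg n : measurable_fun setT (fun x => \int[K x]_y (g n y)%:E).
  exact: measurable_fun_integral_kernel.
transitivity (limn (fun n => \int[m]_x ((D x)%:E * \int[K x]_y (g n y)%:E))).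
  apply: congr_lim; apply/funext => n; rewrite intg.
  rewrite [RHS](eq_integral (fun x => \sum_(r \in range (g n))
      ((D x)%:E * (r%:E * K x (g n @^-1` [set r]))))); last first.
    by move=> x _; rewrite intg ge0_mule_fsumr// => r; rewrite nnsfun_mulemu_ge0.
  rewrite ge0_integral_fsum//; last first.
    move=> r; apply: emeasurable_funM; first exact/measurable_EFinP.
    by apply: measurable_funeM; exact: mK.
  apply: eq_fsbigr => r _; rewrite /mixture.
  have [r0|r0] := leP 0%R r.
    rewrite -ge0_integralZl//; [|exact: mDK|by move=> x _; rewrite mule_ge0// lee_fin].
    by apply: eq_integral => x _; rewrite muleCA.
  have -> : g n @^-1` [set r] = set0 by exact: preimage_nnfun0.
  rewrite measure0 mule0 integral0_eq//.
  by move=> x _; rewrite measure0 !mule0.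
rewrite -monotone_convergence//.
- apply: eq_integral => x _.
  rewrite limeMl//.
    rewrite -monotone_convergence//; last by move=> y _ a b; exact: ndg.
    congr *%E; by apply: eq_integral => y _; rewrite gf.
  apply: ereal_nondecreasing_is_cvgn => a b ab.
  by apply: ge0_le_integral => // y _; exact: ndg.
- by move=> n; apply: emeasurable_funM => //; exact/measurable_EFinP.
- move=> n x _; rewrite mule_ge0 ?lee_fin//; exact: integral_ge0.
- move=> x _ a b ab; apply: lee_pmul => //; rewrite ?lee_fin//.
    exact: integral_ge0.
  by apply: ge0_le_integral => // y _; exact: ndg.
Qed.

End mixture.

(** The mixture of the Dirac masses at [Y x] is the image under [Y] of the measure with density [D].
    It turns identities between weighted integrals into identities between measures, to which
    uniqueness theorems apply. *)
Lemma weighted_law d d' (T : measurableType d) (S : measurableType d')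
    (R : realType) (m : {measure set T -> \bar R}) (D : T -> R) (Y : T -> S) :
    (forall x, 0 <= D x) -> measurable_fun setT D -> measurable_fun setT Y ->
  exists nu : {measure set S -> \bar R},
  (forall B, nu B = \int[m]_x (D x * \1_B (Y x))%:E)%E /\
  forall f : S -> \bar R, (forall y, (0 <= f y)%E) -> measurable_fun setT f ->
    (\int[nu]_y f y = \int[m]_x ((D x)%:E * f (Y x)))%E.
Proof.
move=> D0 mD mY.
have [|nu [nuB nuf]] := @mixture_measure _ _ _ _ _ m D
    (fun x => @dirac _ _ (Y x) R) D0 mD.
  move=> B mB; rewrite /dirac; apply/measurable_EFinP.
  by apply: measurableT_comp => //; exact: measurable_indic.
exists nu; split => [B|f f0 mf].
  by rewrite nuB; apply: eq_integral => x _; rewrite EFinM.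
rewrite nuf//; apply: eq_integral => x _.
by rewrite integral_dirac// diracT mul1e.
Qed.

(** Dynkin's theorem, in which the equality of the finite total masses stands in for an exhausting
    sequence of sets of [G]. *)
Lemma finite_measure_unique d (T : measurableType d) (R : realType)
    (G : set (set T)) (m1 m2 : {measure set T -> \bar R}) :
    G `<=` measurable -> setI_closed G ->
    m1 setT = m2 setT -> (m1 setT < +oo)%E -> (forall A, G A -> m1 A = m2 A) ->
  forall A, <<s G >> A -> m1 A = m2 A.
Proof.
move=> Gm GI mT moo mG A GA.
apply: (g_sigma_algebra_measure_unique_trace G setT) => //.
- by move=> X [/Gm].
- by move=> X Y [GX _] [GY _]; split => //; exact: GI.
- by move=> X [/mG].
- move: A GA; apply: smallest_sub; first exact: smallest_sigma_algebra.
  by move=> X GX; apply: sub_sigma_algebra; split.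
Qed.

Lemma indicM1E (T : Type) (R : realType) (A : set T) (f : T -> \bar R) x :
  ((\1_A x)%:E * f x = (f \_ A) x)%E.
Proof.
by rewrite indicE patchE; case: (x \in A); rewrite ?mul1e ?mul0e.
Qed.

Lemma integral_indicM d (T : measurableType d) (R : realType)
    (m : {measure set T -> \bar R}) (A : set T) (f : T -> \bar R) :
  (\int[m]_(x in A) f x = \int[m]_x ((\1_A x)%:E * f x))%E.
Proof.
by rewrite integral_mkcond; apply: eq_integral => x _; rewrite indicM1E.
Qed.

(** Provides the constant that dominates the Taylor polynomials of the exponential in the moment
    problem. *)
Lemma exp_coeff_sum_le (R : realType) (x c : R) n : `|x| <= c ->
  `|series (exp_coeff x) n| <= expR c.
Proof.
move=> xc; have c0 : 0 <= c by exact: le_trans xc.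
apply: (@le_trans _ _ (series (exp_coeff c) n)).
  rewrite /series/=; apply: (le_trans (ler_norm_sum _ _ _)).
  apply: ler_sum => i _; rewrite normrM normrX (@ger0_norm _ (_^-1))//.
  by rewrite ler_wpM2r// lerXn2r// nnegrE.
apply: nondecreasing_cvgn_le; last exact: is_cvg_series_exp_coeff.
apply/nondecreasing_seqP => k.
by rewrite /series/= big_nat_recr//= lerDl exp_coeff_ge0.
Qed.

(** Bernoulli's inequality only gives a bound of order 1 / n for [x ^+ n]; the exponent [2 * n]
    squares it, which absorbs the factor [n] and leaves 1 / n. *)
Lemma cvg_natM_expr_double (R : realType) (x : R) : 0 <= x < 1 ->
  n%:R * x ^+ (2 * n) @[n --> \oo] --> 0.
Proof.
move=> /andP[x0 x1].
have [->|xN0] := eqVneq x 0.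
  by apply: cvg_near_cst; exists 1%N => // -[//|n] _; rewrite expr0n/= mulr0.
have xp : 0 < x by rewrite lt_neqAle eq_sym xN0.
pose h := x^-1 - 1.
have h0 : 0 < h by rewrite subr_gt0 invf_gt1.
(* Bernoulli: [x ^+ n <= (n h)^-1] *)
have bern n : 1 + n%:R * h <= x^-1 ^+ n.
  elim: n => [|n ih]; first by rewrite mul0r addr0 expr0.
  rewrite exprS (_ : x^-1 = 1 + h); last by rewrite /h; ring.
  have : (1 + h) * (1 + n%:R * h) <= (1 + h) * x^-1 ^+ n.
    by rewrite ler_wpM2l// addr_ge0// ltW.
  rewrite (_ : x^-1 = 1 + h); last by rewrite /h; ring.
  apply: le_trans; rewrite -natr1.
  have : 0 <= n%:R * h ^+ 2 by rewrite mulr_ge0// sqr_ge0.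
  lra.
have bnd n : (0 < n)%N -> n%:R * x ^+ (2 * n) <= (h ^+ 2)^-1 * n%:R^-1.
  move=> n0.
  have nh : 0 < n%:R * h :> R by rewrite mulr_gt0// ltr0n.
  have xn : x ^+ n <= (n%:R * h)^-1.
    rewrite -[leLHS]invrK lef_pV2 ?posrE//; last by rewrite invr_gt0 exprn_gt0.
    by rewrite -exprVn (le_trans _ (bern n))// lerDr.
  rewrite mulnC exprM (@le_trans _ _ (n%:R * (n%:R * h)^-1 ^+ 2))//.
    by rewrite ler_wpM2l// lerXn2r// nnegrE ?exprn_ge0// invr_ge0 ltW.
  have nN0 : n%:R != 0 :> R by rewrite pnatr_eq0 -lt0n.
  have hN0 : h != 0 by rewrite gt_eqF.
  by rewrite le_eqVlt; apply/orP; left; apply/eqP; field; rewrite nN0 hN0.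
apply: (@squeeze_cvgr _ _ _ _ (cst 0) (fun n => (h ^+ 2)^-1 * n%:R^-1)).
- exists 1%N => // n /= n0; rewrite bnd// andbT.
  by rewrite mulr_ge0// exprn_ge0.
- exact: cvg_cst.
- rewrite -[X in _ --> X](mulr0 (h ^+ 2)^-1); apply: cvgM; first exact: cvg_cst.
  rewrite -(cvg_shiftS (fun n => n%:R^-1 : R)); exact: cvg_harmonic.
Qed.

(** * Uniqueness in the Hausdorff moment problem on [0, 1] *)

Section hausdorff_moment.
Context (R : realType).
Local Notation RR := (measurableTypeR R).
Local Notation I := (`[0%R, 1%R]%classic : set RR).
Variables nu1 nu2 : {measure set RR -> \bar R}.
Hypotheses (nu1oo : (nu1 setT < +oo)%E) (nu2oo : (nu2 setT < +oo)%E).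

Let agree (f : R -> R) :=
  (\int[nu1]_(x in I) (f x)%:E = \int[nu2]_(x in I) (f x)%:E)%E.

Let mI : measurable I. Proof. exact: measurable_itv. Qed.

Let nuIoo (nu : {measure set RR -> \bar R}) : (nu setT < +oo -> nu I < +oo)%E.
Proof. by apply: le_lt_trans; apply: le_measure; rewrite ?inE. Qed.

Let bounded_integrable (nu : {measure set RR -> \bar R}) (f : R -> R) (M : R) :
  (nu setT < +oo)%E -> measurable_fun (setT : set RR) f -> (forall x, I x -> `|f x| <= M) ->
  nu.-integrable I (EFin \o f).
Proof.
move=> nuoo mf fM; apply: measurable_bounded_integrable => //.
- exact: nuIoo.
- exact: measurable_funTS.
- exists M; split; first exact: num_real.
  by move=> N MN x /fM /le_trans; apply; exact: ltW.
Qed.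

Let agree_lim (f_ : nat -> R -> R) (f : R -> R) (M : R) :
  (forall n, measurable_fun (setT : set RR) (f_ n)) -> (forall n, agree (f_ n)) ->
  (forall n x, I x -> `|f_ n x| <= M) ->
  (forall x, I x -> f_ n x @[n --> \oo] --> f x) -> agree f.
Proof.
move=> mf_ f_agree f_M f_f.
have cvgf (nu : {measure set RR -> \bar R}) : (nu setT < +oo)%E ->
    (\int[nu]_(x in I) (f_ n x)%:E @[n --> \oo] --> \int[nu]_(x in I) (f x)%:E)%E.
  move=> nuoo; apply: (@dominated_cvg _ _ _ _ _ mI _ _ (cst `|M|%:E)) => //.
  - by move=> n; apply/measurable_EFinP; exact: measurable_funTS.
  - by move=> x Ix; exact: (cvg_comp _ _ (f_f x Ix)).
  - by apply: (bounded_integrable (M := `|M|) nuoo) => // x _; rewrite normr_id.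
  - by move=> n x Ix; rewrite lee_fin (le_trans (f_M n x Ix))// ler_norm.
have c1 := cvgf _ nu1oo; have c2 := cvgf _ nu2oo; rewrite /agree.
rewrite -(cvg_lim _ c1)// -(cvg_lim _ c2)//.
by apply: congr_lim; apply/funext => n; exact: f_agree.
Qed.

Let agree_sum (f_ : nat -> R -> R) (M : nat -> R) n :
  (forall n, measurable_fun (setT : set RR) (f_ n)) -> (forall n, agree (f_ n)) ->
  (forall n x, I x -> `|f_ n x| <= M n) ->
  agree (fun x => \sum_(0 <= i < n) f_ i x).
Proof.
move=> mf_ f_agree f_M; rewrite /agree.
under eq_integral do rewrite -sumEFin.
under [RHS]eq_integral do rewrite -sumEFin.
rewrite !integral_sum//.
- by apply: eq_bigr => i _; exact: f_agree.
- by move=> i; exact: (bounded_integrable nu2oo (mf_ i) (f_M i)).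
- by move=> i; exact: (bounded_integrable nu1oo (mf_ i) (f_M i)).
Qed.

Hypothesis moment : forall n, agree (fun x => x ^+ n).

(** The Taylor polynomials of the exponential, taken at - c x^k, are polynomials in [x] and converge
    boundedly on [0, 1]; their terms are multiples of the moments of order [k * i]. *)
Let agree_expR c k : 0 <= c -> agree (fun x => expR (- (c * x ^+ k))).
Proof.
move=> c0; have cM n x : I x -> `|- (c * x ^+ k)| <= c.
  rewrite /= in_itv/= => /andP[x0 x1].
  by rewrite normrN ger0_norm ?mulr_ge0 ?exprn_ge0// ler_piMr// exprn_ile1.
apply: (@agree_lim (fun n x => series (exp_coeff (- (c * x ^+ k))) n) _ (expR c)).
- move=> n; rewrite /series/=; apply: measurable_sum => i.
  apply: measurable_funM => //; apply: measurable_funX.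
  apply: measurable_funN; apply: measurable_funM => //.
- move=> n; rewrite /series/=.
  apply: (@agree_sum _ (fun i => `|(- c) ^+ i / i`!%:R|)) => [i|i|i x].
  + apply: measurable_funM => //; apply: measurable_funX.
    apply: measurable_funN; apply: measurable_funM => //.
  + have E (nu : {measure set RR -> \bar R}) : (nu setT < +oo)%E ->
      (\int[nu]_(x in I) ((- (c * x ^+ k)) ^+ i / i`!%:R)%:E =
       ((- c) ^+ i / i`!%:R)%:E * \int[nu]_(x in I) (x ^+ (k * i))%:E)%E.
      move=> nuoo; rewrite -integralZl//.
        apply: eq_integral => x _; rewrite -EFinM; congr EFin.
        by rewrite -mulNr exprMn -exprM; ring.
      apply: (bounded_integrable (M := 1) nuoo) => // x; rewrite /= in_itv/= => /andP[x0 x1].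
      by rewrite ger0_norm ?exprn_ge0// exprn_ile1.
    by rewrite /agree !E// moment.
  + rewrite /= in_itv/= => /andP[x0 x1]; rewrite -mulNr.
    rewrite /exp_coeff/= exprMn !normrM ler_wpM2r// ler_piMr// ger0_norm ?exprn_ge0//.
    by rewrite exprn_ile1// ?exprn_ge0// exprn_ile1.
- by move=> n x Ix; apply: exp_coeff_sum_le; exact: cM.
- by move=> x Ix; exact: is_cvg_series_exp_coeff.
Qed.

(* [expR (- n (x / r) ^ 2n)] tends to [1] for [0 <= x < r] and to [0] for
   [x >= r]; the factor [n] kills the limit at [x = r]. *)
Let agree_ray r : agree (\1_(`]-oo, r[%classic : set RR)).
Proof.
have [r0|r0] := leP r 0.
  rewrite /agree !integral0_eq// => x; rewrite /= in_itv/= => /andP[x0 _].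
    by rewrite indicE memNset//= in_itv/=; apply/negP; rewrite -leNgt (le_trans r0).
  by rewrite indicE memNset//= in_itv/=; apply/negP; rewrite -leNgt (le_trans r0).
have rN0 : r != 0 by rewrite gt_eqF.
apply: (@agree_lim (fun n x => expR (- (n%:R * (r^-1 ^+ (2 * n)) * x ^+ (2 * n))))
    _ 1).
- move=> n; apply: measurableT_comp => //; apply: measurable_funN.
  by apply: measurable_funM => //; exact: measurable_funX.
- by move=> n; apply: agree_expR; rewrite mulr_ge0// exprn_ge0// invr_ge0 ltW.
- move=> n x; rewrite /= in_itv/= => /andP[x0 x1].
  rewrite ger0_norm ?expR_ge0// expR_le1 oppr_le0 !mulr_ge0// exprn_ge0//.
  by rewrite invr_ge0 ltW.
- move=> x; rewrite /= in_itv/= => /andP[x0 x1].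
  under eq_fun do rewrite -mulrA -exprMn mulrC.
  have q0 : 0 <= r^-1 * x by rewrite mulr_ge0// invr_ge0 ltW.
  rewrite indicE; have [xr|rx] := ltP x r.
    rewrite mem_set; last by rewrite /= in_itv.
    rewrite (_ : true%:R = expR (- 0)); last by rewrite oppr0 expR0.
    apply: continuous_cvg; first exact: continuous_expR.
    apply: cvgN; under eq_fun do rewrite mulrC.
    by apply: cvg_natM_expr_double; rewrite q0/= mulrC ltr_pdivrMr// mul1r.
  rewrite memNset/=; last by rewrite in_itv/=; apply/negP; rewrite -leNgt.
  apply: (@squeeze_cvgr _ _ _ _ (cst 0) (fun n => expR (- n%:R))).
  - apply: nearW => n; rewrite expR_ge0/= ler_expR lerN2.
    by rewrite ler_peMl// exprn_ege1// mulrC ler_pdivlMr// mul1r.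
  - exact: cvg_cst.
  - exact: cvgn_expR.
Qed.

Lemma hausdorff_moment : nu1 (~` I) = 0%E -> nu2 (~` I) = 0%E ->
  forall B, measurable B -> nu1 B = nu2 B.
Proof.
move=> nu1I nu2I B mB.
have cap (nu : {measure set RR -> \bar R}) A : measurable A ->
    nu (~` I) = 0%E -> nu A = nu (A `&` I).
  move=> mA nuI; rewrite -[A in LHS](setDUK (@subIsetl _ A I)) measureU//.
  - rewrite [X in (_ + X)%E](_ : _ = 0%E) ?adde0//.
    apply: (@subset_measure0 _ _ _ nu _ (~` I)) => //.
    + by apply: measurableD => //; exact: measurableI.
    + exact: measurableC.
    + by move=> x [Ax AIx] Ix; apply: AIx.
  - exact: measurableI.
  - by apply: measurableD => //; exact: measurableI.
  - by rewrite setDIK.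
have rays r : nu1 `]-oo, r[%classic = nu2 `]-oo, r[%classic.
  have mr : measurable (`]-oo, r[%classic : set RR) by exact: measurable_itv.
  rewrite (cap nu1)// (cap nu2)//.
  by have := agree_ray r; rewrite /agree !integral_indic//.
have nuT : nu1 setT = nu2 setT.
  rewrite (cap nu1)// (cap nu2)// !setTI.
  have := moment 0; rewrite /agree.
  by under eq_integral do rewrite expr0; under [X in _ = X -> _]eq_integral do
    rewrite expr0; rewrite !integral_cst// !mul1e.
have GB : <<s @RGenInftyO.G R >> B by have := mB; rewrite RGenInftyO.measurableE.
apply: (@finite_measure_unique _ RR R _ nu1 nu2 _ _ nuT nu1oo _ B GB).
- by move=> _ [r ->]; exact: measurable_itv.
- move=> _ _ [r ->] [s ->]; exists (Num.min r s); apply/seteqP; split => x /=;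
    rewrite !in_itv/= lt_min; first by move=> [-> ->].
  by move=> /andP[].
- by move=> _ [r ->].
Qed.

End hausdorff_moment.

(** * Laplace functional of a Poisson random measure *)

Section negexp.
Context {R : realType}.
Implicit Types x y : \bar R.

(* [exp(-y)] for [y] in [0, +oo], with [exp(-oo) = 0]; junk value [0] at [-oo]. *)
Definition negexp y : R := if y is r%:E then expR (- r) else 0.

Lemma negexp0 : negexp 0%E = 1.
Proof. by rewrite /= oppr0 expR0. Qed.

Lemma negexp_ge0 y : 0 <= negexp y.
Proof. by case: y => [r| |]//=; exact: expR_ge0. Qed.

Lemma negexp_le1 y : (0 <= y)%E -> negexp y <= 1.
Proof. by case: y => [r| |]//=; rewrite lee_fin expR_le1 oppr_le0. Qed.

Lemma negexpD x y : negexp (x + y)%E = negexp x * negexp y.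
Proof.
by case: x y => [r| |] [s| |]//=; rewrite ?mulr0 ?mul0r// opprD expRD.
Qed.

Lemma negexp_sum (I : Type) (s : seq I) (f : I -> \bar R) :
  negexp (\sum_(i <- s) f i)%E = \prod_(i <- s) negexp (f i).
Proof.
elim: s => [|i s ih]; first by rewrite !big_nil negexp0.
by rewrite !big_cons negexpD ih.
Qed.

Lemma negexp_natM n y : (0 <= y)%E -> negexp (n%:R%:E * y)%E = negexp y ^+ n.
Proof.
case: y => [r _|_|//]; first by rewrite -EFinM /= -mulrN expRM_natl.
(* At [y = +oo] the case [n = 0] is special: [0 * +oo = 0], so both sides are 1 there and 0 for
   positive [n]. *)
case: n => [|n]; first by rewrite mul0e expr0 negexp0.
by rewrite gt0_muley ?lte_fin ?ltr0n//= expr0n.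
Qed.

Lemma measurable_negexp : measurable_fun setT negexp.
Proof.
rewrite (_ : negexp = fun y => if y \is a fin_num then expR (- fine y) else 0).
  apply: measurable_fun_if => //.
  - by apply: (measurable_fun_bool true); apply: emeasurable_fin_num.
  - apply: measurable_funTS; apply: measurableT_comp => //.
    by apply: measurable_funN; exact: fine_measurable.
by apply/funext => -[].
Qed.

Lemma cvg_negexp (u : (\bar R)^nat) y : (0 <= y)%E -> u @ \oo --> y ->
  negexp (u n) @[n --> \oo] --> negexp y.
Proof.
case: y => [r _ ur|_ uy|//] /=.
  have [ufin /= fur] := (fine_cvgP _ _).1 ur.
  apply: cvg_trans (_ : expR (- fine (u n)) @[n --> \oo] --> expR (- r)).
    apply: near_eq_cvg; near=> n.
    have : u n \is a fin_num by near: n.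
    by case: (u n).
  apply: continuous_cvg; first exact: continuous_expR.
  exact: cvgN.
apply/cvgrPdist_le => e e0; near=> n.
have uM : ((- ln e)%:E <= u n)%E.
  by near: n; move/cvgeyPge : uy; apply.
rewrite sub0r normrN ger0_norm ?negexp_ge0//.
case: (u n) uM => [s|_|//] /=; last exact: ltW.
by rewrite lee_fin => es; rewrite -[leRHS]lnK ?posrE// ler_expR lerNl.
Unshelve. all: by end_near. Qed.

End negexp.

Section independence.
Context d d' (T : measurableType d) (S : measurableType d') (R : realType)
  (P : probability T R) (n : nat) (Y : 'I_n -> T -> S).
Hypotheses (mY : forall i, measurable_fun setT (Y i))
  (indepY : forall B : 'I_n -> set S, (forall i, measurable (B i)) ->
     P [set o | forall i, B i (Y i o)] = (\prod_(i < n) P [set o | B i (Y i o)])%E).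

(* The factors are turned from indicators into functions one index at a time. *)
Let expectation_prod_upto k (h : 'I_n -> S -> R) :
  (forall i, measurable_fun setT (h i)) -> (forall i y, 0 <= h i y <= 1) ->
  (forall i : 'I_n, (k <= i)%N -> exists2 B, measurable B & h i = \1_B) ->
  (\int[P]_o (\prod_(i < n) h i (Y i o))%:E =
   \prod_(i < n) \int[P]_o (h i (Y i o))%:E)%E.
Proof.
elim: k h => [h mh h01 hB|k IH h mh h01 hB].
  pose B i := sval (cid2 (hB i (leq0n i))).
  have mB i : measurable (B i) by rewrite /B; case: cid2.
  have hE i : h i = \1_(B i) by rewrite /B; case: cid2.
  have mYB i : measurable [set o | B i (Y i o)].
    by rewrite -[X in measurable X]setTI; exact: mY.
  have pI o : \prod_(i < n) h i (Y i o) = \1_[set o | forall i, B i (Y i o)] o.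
    rewrite indicE; case: (asboolP (forall i, B i (Y i o))) => Bo.
      rewrite mem_set// big1// => i _; rewrite hE indicE mem_set//.
    rewrite memNset//; have /existsNP[i Bi] := Bo.
    by rewrite (bigD1 i)//= hE indicE memNset// mul0r.
  under eq_integral do rewrite pI.
  have mB' : measurable [set o | forall i, B i (Y i o)].
    rewrite (_ : mkset _ = \bigcap_(i in setT) [set o | B i (Y i o)]).
      exact: fin_bigcap_measurable.
    by apply/seteqP; split => [ o Bo i _ | o Bo i]; exact: Bo.
  rewrite integral_indic// setIT. apply: (etrans (indepY mB)).
  apply: eq_bigr => i _; rewrite hE.
  rewrite (_ : (fun o => _) = fun o => (\1_[set o | B i (Y i o)] o)%:E).
    by rewrite integral_indic// setIT.
  by apply/funext => o; rewrite !indicE; congr (_%:R%:E); apply/idP/idP; rewrite !inE.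
have [nk|kn] := leqP n k.
  by apply: IH => // i ki; have := leq_trans nk ki; rewrite leqNgt ltn_ord.
pose j := Ordinal kn; pose D (o : T) := \prod_(i < n | i != j) h i (Y i o).
have D0 o : 0 <= D o by apply: prodr_ge0 => i _; case/andP: (h01 i (Y i o)).
have mhY i : measurable_fun setT (h i \o Y i) by exact: measurableT_comp.
have mD : measurable_fun setT D.
  rewrite (_ : D = fun o => \prod_(i < n) (if i != j then h i (Y i o) else 1)).
    by apply: measurable_prod => i _; case: (i != j) => //; exact: mhY.
  by apply/funext => o; rewrite /D big_mkcond.
have [nu [nuB nuf]] := weighted_law P D0 mD (mY j).
have [mu [muB muf]] := @weighted_law _ _ _ _ R P (fun=> 1)
  (Y j) (fun=> ler01) (measurable_cst _) (mY j).
pose C := (\prod_(i < n | i != j) \int[P]_o (h i (Y i o))%:E)%E.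
have [c c0 CE] : exists2 c : R, 0 <= c & C = c%:E.
  exists (fine C); rewrite ?fineK ?fine_ge0//.
    apply: prode_ge0 => i _; apply: integral_ge0 => o _.
    by rewrite lee_fin; case/andP: (h01 i (Y i o)).
  apply: prode_fin_num => i _.
  rewrite ge0_fin_numE; last first.
    by apply: integral_ge0 => o _; rewrite lee_fin; case/andP: (h01 i (Y i o)).
  apply: (@le_lt_trans _ _ (\int[P]_o 1)%E); last first.
    rewrite integral_cst// mul1e.
    exact: le_lt_trans (probability_le1 P measurableT) (ltry 1).
  apply: ge0_le_integral => //.
  - by move=> o _; rewrite lee_fin; case/andP: (h01 i (Y i o)).
  - by apply/measurable_EFinP; exact: mhY.
  - by move=> o _; rewrite lee_fin; case/andP: (h01 i (Y i o)).
(* The law of [Y j] weighted by the other factors is [C] times the law of [Y j]: on a set [B] this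
   is the induction hypothesis for the family in which [\1_B] replaces [h j]. *)
have nuE B : measurable B -> nu B = (mscale (NngNum c0) mu) B.
  move=> mB; rewrite nuB /mscale/= muB -CE.
  pose h1 (i : 'I_n) := if i == j then \1_B else h i.
  have h1j : h1 j = \1_B by rewrite /h1 eqxx.
  have h1N i : i != j -> h1 i = h i by rewrite /h1 => /negbTE ->.
  transitivity (\int[P]_o (\prod_(i < n) h1 i (Y i o))%:E)%E.
    apply: eq_integral => o _; congr EFin; rewrite [RHS](bigD1 j)//= h1j mulrC.
    by congr *%R; apply: eq_bigr => i ij; rewrite h1N.
  rewrite IH.
  - rewrite (bigD1 j)//= h1j muleC; congr *%E.
      by apply: eq_bigr => i ij; rewrite h1N.
    by apply: eq_integral => o _; rewrite mul1r.
  - by move=> i; rewrite /h1; case: ifP => // _; exact: measurable_indic.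
  - move=> i y; rewrite /h1; case: ifP => // _; rewrite indicE.
    by case: (_ \in _); rewrite ?lexx ?ler01.
  - move=> i ki; rewrite /h1; case: eqVneq => [_|ij]; first by exists B.
    apply: hB; rewrite ltn_neqAle ki andbT; apply: contra ij => /eqP ki'.
    by apply/eqP/val_inj.
have hj0 y : (0 <= (h j y)%:E)%E by rewrite lee_fin; case/andP: (h01 j y).
have mhj : measurable_fun setT (fun y => (h j y)%:E) by exact/measurable_EFinP.
transitivity (\int[nu]_y (h j y)%:E)%E.
  rewrite nuf//; apply: eq_integral => o _.
  by rewrite -EFinM (bigD1 j)//= mulrC.
rewrite (eq_measure_integral (mscale (NngNum c0) mu)); last by move=> A mA _; exact: nuE.
rewrite ge0_integral_mscale//= muf// -CE (bigD1 j)//= muleC; congr *%E.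
by apply: eq_integral => o _; rewrite mul1e.
Qed.

Lemma expectation_prod (h : 'I_n -> S -> R) :
  (forall i, measurable_fun setT (h i)) -> (forall i y, 0 <= h i y <= 1) ->
  (\int[P]_o (\prod_(i < n) h i (Y i o))%:E =
   \prod_(i < n) \int[P]_o (h i (Y i o))%:E)%E.
Proof.
move=> mh h01; apply: (@expectation_prod_upto n) => // i.
by rewrite leqNgt ltn_ord.
Qed.

End independence.

(** At rate 0 [poisson_prob] is the Dirac mass at 0, which fits the formula because [0 ^+ 0 = 1].
    Rate 0 does occur, for null sets and for [z = 0]. *)
Lemma poisson_prob_set1 (R : realType) (r : R) (k : nat) : 0 <= r ->
  poisson_prob r k [set k] = (r ^+ k / k`!%:R * expR (- r))%:E.
Proof.
rewrite le_eqVlt => /predU1P[<-|r0].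
  rewrite /poisson_prob ltxx diracE oppr0 expR0 mulr1; case: k => [|k].
    by rewrite mem_set//= expr0 mul1r fact0 invr1.
  by rewrite memNset//= expr0n/= mul0r.
by rewrite /poisson_prob r0 esum_set1 ?lee_fin ?poisson_pmf_ge0// /poisson_pmf r0.
Qed.

(** The probability generating function, taken below at [s = 1] for the total mass and at
    [s = expR (- a)] for the Laplace transform. *)
Lemma poisson_gen (R : realType) (r s : R) : 0 <= r -> 0 <= s ->
  (\sum_(k <oo) (s ^+ k * (r ^+ k / k`!%:R * expR (- r)))%:E =
   (expR (- (r * (1 - s))))%:E)%E.
Proof.
move=> r0 s0.
have -> : expR (- (r * (1 - s))) = expR (- r) * expR (r * s).
  by rewrite -expRD; congr expR; ring.
transitivity (\sum_(k <oo) ((expR (- r))%:E * (exp_coeff (r * s) k)%:E))%E.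
  apply: eq_eseriesr => k _; rewrite -EFinM /exp_coeff/=; congr EFin.
  by rewrite exprMn; ring.
rewrite nneseriesZl; last first.
  by move=> k _; rewrite lee_fin exp_coeff_ge0// mulr_ge0.
rewrite EFinM; congr *%E; rewrite /expR -EFin_lim; last first.
  exact: is_cvg_series_exp_coeff.
by apply/congr_lim/funext => n /=; rewrite /series/= sumEFin.
Qed.

Section poisson_variable.
Context d (T : measurableType d) (R : realType) (P : probability T R)
  (Y : T -> \bar R) (r : R).
Hypotheses (mY : measurable_fun setT Y) (r0 : 0 <= r)
  (PY : forall k : nat, P [set o | Y o = k%:R%:E] = poisson_prob r k [set k]).

(** [Y] is known only through the probabilities of its natural values. These add up to 1, so the
    event that [Y] takes another value is null and the integral is a series over the values. *)
Lemma poisson_laplace a : 0 <= a ->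
  (\int[P]_o (negexp (a%:E * Y o))%:E = (expR (- (r * (1 - expR (- a)))))%:E)%E.
Proof.
move=> a0; pose F k := [set o | Y o = k%:R%:E].
have mF k : measurable (F k).
  have -> : F k = setT `&` Y @^-1` [set k%:R%:E] by rewrite setTI.
  exact: mY.
have tF : trivIset setT F.
  apply/trivIsetP => i j _ _ ij; rewrite -subset0 => o /= [Yi Yj].
  by have /eqP := etrans (esym Yi) Yj; rewrite eqe eqr_nat (negbTE ij).
have mg : measurable_fun setT (fun o => (negexp (a%:E * Y o))%:E).
  apply/measurable_EFinP; apply: measurableT_comp; first exact: measurable_negexp.
  exact: measurable_funeM.
have PF k : P (F k) = (r ^+ k / k`!%:R * expR (- r))%:E.
  by rewrite -poisson_prob_set1//; exact: PY.
have PU : P (\bigcup_k F k) = 1%E.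
  rewrite measure_bigcup//.
  transitivity (\sum_(k <oo) (1 ^+ k * (r ^+ k / k`!%:R * expR (- r)))%:E)%E.
    rewrite [RHS]eseries_mkcond [LHS]eseries_mkcond; apply: eq_eseriesr => k _.
    by rewrite mem_set// expr1n mul1r; exact: PF.
  by rewrite poisson_gen// subrr mulr0 oppr0 expR0.
have PC : P (~` \bigcup_k F k) = 0%E.
  rewrite probability_setC ?PU ?subee//; exact: bigcup_measurable.
rewrite (@ge0_negligible_integral _ _ _ P _ (~` \bigcup_k F k))//; last 2 first.
  - by apply: measurableC; exact: bigcup_measurable.
  - by move=> o _; rewrite lee_fin negexp_ge0.
rewrite setTD setCK ge0_integral_bigcup//; last 2 first.
  - exact: measurable_funTS.
  - by move=> o _; rewrite lee_fin negexp_ge0.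
rewrite -poisson_gen ?expR_ge0//; apply: eq_eseriesr => k _.
rewrite (eq_integral (cst (expR (- a) ^+ k)%:E)); last first.
  move=> o; rewrite inE /F/= => ->; rewrite -EFinM/=; congr EFin.
  by rewrite -expRM_natr mulNr.
by rewrite integral_cst// EFinM; congr *%E; exact: PF.
Qed.

End poisson_variable.

(** The value 0 is kept out of [a] because its level set may have infinite measure; [f 0 = 0] makes
    it contribute nothing. The cases in use are the identity for [N] and [1 - expR (- r)] for the
    intensity. *)
Lemma ge0_integral_finite_range d (T : measurableType d) (R : realType)
    (nu : {measure set T -> \bar R}) (h : T -> R) (a : seq R) (f : R -> R) :
    measurable_fun setT h -> uniq a -> (forall x, h x != 0 -> h x \in a) ->
    0 \notin a -> f 0 = 0 -> (forall r, 0 <= r -> 0 <= f r) -> {in a, forall r, 0 <= r} ->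
  (\int[nu]_x (f (h x))%:E =
   \sum_(i < size a) (f a`_i)%:E * nu (h @^-1` [set a`_i]))%E.
Proof.
move=> mh ua ha a0 f0 f_ge0 a_ge0.
have mA i : measurable (h @^-1` [set a`_i]).
  by rewrite -[X in measurable X]setTI; exact: mh.
have ai (i : 'I_(size a)) : 0 <= a`_i by apply: a_ge0; exact: mem_nth.
have fh x : f (h x) = \sum_(i < size a) f a`_i * \1_(h @^-1` [set a`_i]) x.
  have [hx0|hx0] := eqVneq (h x) 0.
    rewrite hx0 f0 big1// => i _; rewrite indicE memNset ?mulr0//= hx0 => ai0.
    by move/negP: a0; apply; rewrite ai0 mem_nth.
  have hxa := ha _ hx0; have ia : (index (h x) a < size a)%N by rewrite index_mem.
  rewrite (bigD1 (Ordinal ia))//= indicE mem_set/= ?nth_index// mulr1.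
  rewrite big1 ?addr0// => i ij; rewrite indicE memNset ?mulr0//= => hxi.
  by move/eqP: ij; apply; apply/val_inj; rewrite /= hxi index_uniq.
under eq_integral do rewrite fh -sumEFin.
rewrite ge0_integral_sum//; last 2 first.
- by move=> i; apply/measurable_EFinP; apply: measurable_funM.
- by move=> i x _; rewrite lee_fin mulr_ge0// f_ge0.
apply: eq_bigr => i _; under eq_integral do rewrite EFinM.
rewrite ge0_integralZl//.
- by rewrite integral_indic// setIT.
- exact/measurable_EFinP.
- by rewrite lee_fin f_ge0.
Qed.

Section laplace_functional.
Import HBNNSimple.
Context d d' (Omega : measurableType d) (E : measurableType d') (R : realType)
  (P : probability Omega R) (N : R.-ker Omega ~> E) (mu : {measure set E -> \bar R}).
Hypothesis hN : is_poisson_random_measure P N mu.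

Let laplace_finite_range (h : E -> R) (a : seq R) :
    measurable_fun setT h -> uniq a -> {in a, forall r, 0 < r} ->
    (forall x, h x != 0 -> h x \in a) -> (mu [set x | h x != 0%R] < +oo)%E ->
  (\int[P]_o (negexp (\int[N o]_w (h w)%:E))%:E =
   (negexp (\int[mu]_w (1 - expR (- h w))%:E))%:E)%E.
Proof.
move=> mh ua a0 ha muoo.
have a0N : 0 \notin a by apply/negP => /a0; rewrite ltxx.
have a_ge0 : {in a, forall r, 0 <= r} by move=> r /a0/ltW.
pose A (i : 'I_(size a)) := h @^-1` [set a`_i].
have ai (i : 'I_(size a)) : 0 < a`_i by apply: a0; exact: mem_nth.
have mA i : measurable (A i).
  by rewrite -[X in measurable X]setTI; exact: mh.
have Aoo i : (mu (A i) < +oo)%E.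
  apply: le_lt_trans muoo; apply: le_measure; rewrite ?inE//.
    rewrite (_ : mkset _ = ~` (h @^-1` [set 0])); last first.
      by apply/seteqP; split => x /= /eqP.
    by apply: measurableC; rewrite -[X in measurable X]setTI; exact: mh.
  by move=> x /= ->; rewrite gt_eqF.
have tA : trivIset setT A.
  apply/trivIsetP => i j _ _ ij; rewrite -subset0 => x [/= hi hj].
  move/eqP: ij; apply; apply/val_inj/eqP.
  by rewrite -(nth_uniq 0 (ltn_ord i) (ltn_ord j) ua) -hi -hj.
have mN i : measurable_fun setT (fun o => N o (A i)) by exact: measurable_kernel.
(* The absolute value changes nothing at counts; it is there because [expectation_prod] bounds its
   factors by 1 on all of [\bar R], while [negexp] exceeds 1 at negative reals. *)
pose g (i : 'I_(size a)) (y : \bar R) := negexp ((a`_i)%:E * `|y|)%E.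
transitivity (\int[P]_o (\prod_(i < size a) g i (N o (A i)))%:E)%E.
  apply: eq_integral => o _; congr EFin.
  rewrite (@ge0_integral_finite_range _ _ _ _ h a id)// negexp_sum.
  by apply: eq_bigr => i _; rewrite /g gee0_abs.
have [hN1 hN2] := hN.
rewrite (@expectation_prod _ _ _ _ _ P _ (fun i o => N o (A i))); first last.
- move=> i y; rewrite negexp_ge0 negexp_le1// mule_ge0// lee_fin; exact: ltW.
- move=> i; apply: measurableT_comp; first exact: measurable_negexp.
  by apply: measurable_funeM; exact: abse_measurable.
- by move=> B mB; exact: hN2.
- by [].
rewrite (@ge0_integral_finite_range _ _ _ _ h a (fun r => 1 - expR (- r)))//; first last.
- by move=> r r0; rewrite subr_ge0 expR_le1 oppr_le0.
- by rewrite oppr0 expR0 subrr.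
rewrite negexp_sum -prodEFin; apply: eq_bigr => i _.
have Afin : mu (A i) \is a fin_num by rewrite ge0_fin_numE.
rewrite -[in RHS](fineK Afin) -EFinM/= mulrC.
have mui0 : 0 <= fine (mu (A i)) by exact: fine_ge0.
have := poisson_laplace (mN i) mui0 (hN1 _ (mA i) (Aoo i)) (ltW (ai i)).
by move=> <-; apply: eq_integral => o _; rewrite /g gee0_abs.
Qed.

Lemma laplace_functional (f : E -> R) :
  sigma_finite setT mu -> measurable_fun setT f -> (forall x, 0 <= f x) ->
  (\int[P]_o (negexp (\int[N o]_w (f w)%:E))%:E =
   (negexp (\int[mu]_w (1 - expR (- f w))%:E))%:E)%E.
Proof.
move=> /sigma_finiteP[F [FT ndF Foo]] mf f0.
have mF n : measurable (F n) by case: (Foo n).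
have mEf : measurable_fun setT (fun x => (f x)%:E) by exact/measurable_EFinP.
pose g := nnsfun_approx measurableT mEf.
(* The truncation to [F n] gives the nonzero level sets of [h n] finite intensity, and [ndF] keeps
   the sequence nondecreasing, so both exponents converge monotonically. *)
pose h n x := g n x * \1_(F n) x.
have h0 n x : 0 <= h n x by rewrite mulr_ge0.
have mh n : measurable_fun setT (h n) by exact: measurable_funM.
have ndh x a b : (a <= b)%N -> h a x <= h b x.
  move=> ab; apply: ler_pM => //; first exact/lefP/nd_nnsfun_approx.
  rewrite !indicE ler_nat; case: (boolP (x \in F a)) => // /set_mem xa.
  by rewrite mem_set//; move/subsetPset: (ndF _ _ ab); exact.
have hf x : h n x @[n --> \oo] --> f x.
  have [n0 _ xn0] : (\bigcup_i F i) x by rewrite -FT.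
  apply: cvg_trans (_ : g n x @[n --> \oo] --> f x).
    apply: near_eq_cvg; exists n0 => // n /= n0n; rewrite /h indicE mem_set ?mulr1//.
    by move/subsetPset: (ndF _ _ n0n); exact.
  have : (g n x)%:E @[n --> \oo] --> (f x)%:E.
    by apply: (cvg_nnsfun_approx measurableT mEf) => // y _; rewrite lee_fin.
  by move/fine_cvgP => [].
have intN o : (\int[N o]_w (h n w)%:E @[n --> \oo] --> \int[N o]_w (f w)%:E)%E.
  have -> : (\int[N o]_w (f w)%:E = \int[N o]_w limn (fun n => (h n w)%:E))%E.
    apply: eq_integral => w _; apply/esym/cvg_lim => //.
    exact: (cvg_comp _ _ (hf w)).
  apply: cvg_monotone_convergence => //.
  - by move=> n; exact/measurable_EFinP.
  - by move=> n w _; rewrite lee_fin.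
  - by move=> w _ a b ab; rewrite lee_fin ndh.
have intmu : (\int[mu]_w (1 - expR (- h n w))%:E @[n --> \oo] -->
    \int[mu]_w (1 - expR (- f w))%:E)%E.
  have -> : (\int[mu]_w (1 - expR (- f w))%:E =
      \int[mu]_w limn (fun n => (1 - expR (- h n w))%:E))%E.
    apply: eq_integral => w _; apply/esym/cvg_lim => //.
    apply: (@cvg_comp _ _ _ (fun n => 1 - expR (- h n w)) EFin _ (nbhs (1 - expR (- f w)))) => //.
    apply: cvgB; first exact: cvg_cst.
    apply: continuous_cvg; first exact: continuous_expR.
    by apply: cvgN; exact: hf.
  apply: cvg_monotone_convergence => //.
  - move=> n; apply/measurable_EFinP; apply: measurable_funB => //.
    by apply: measurableT_comp => //; exact: measurable_funN.
  - by move=> n w _; rewrite lee_fin subr_ge0 expR_le1 oppr_le0.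
  - by move=> w _ a b ab; rewrite lee_fin lerD2l lerN2 ler_expR lerN2 ndh.
have mNf (k : E -> R) : measurable_fun setT k -> (forall x, 0 <= k x) ->
    measurable_fun setT (fun o => (negexp (\int[N o]_w (k w)%:E))%:E).
  move=> mk k0; apply/measurable_EFinP.
  apply: measurableT_comp; first exact: measurable_negexp.
  apply: measurable_fun_integral_kernel => //.
  - by move=> U mU; exact: measurable_kernel.
  - exact/measurable_EFinP.
have lhs : (\int[P]_o (negexp (\int[N o]_w (h n w)%:E))%:E @[n --> \oo] -->
    \int[P]_o (negexp (\int[N o]_w (f w)%:E))%:E)%E.
  apply: (@dominated_cvg _ _ _ _ _ _ _ _ (cst 1%E)) => //.
  - by move=> n; exact: mNf.
  - move=> o _; apply: (@cvg_comp _ _ _ (fun n => negexp (\int[N o]_w (h n w)%:E)%E) EFin _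
      (nbhs (negexp (\int[N o]_w (f w)%:E)%E))) => //.
    by apply: cvg_negexp => //; apply: integral_ge0 => w _; rewrite lee_fin.
  - exact: finite_measure_integrable_cst.
  - move=> n o _; rewrite gee0_abs ?lee_fin ?negexp_ge0// negexp_le1//.
    by apply: integral_ge0 => w _; rewrite lee_fin.
have rhs : (negexp (\int[mu]_w (1 - expR (- h n w))%:E)%E)%:E @[n --> \oo] -->
    (negexp (\int[mu]_w (1 - expR (- f w))%:E)%E)%:E.
  apply: (@cvg_comp _ _ _ (fun n => negexp (\int[mu]_w (1 - expR (- h n w))%:E)%E) EFin _
      (nbhs (negexp (\int[mu]_w (1 - expR (- f w))%:E)%E))) => //.
  apply: cvg_negexp => //; apply: integral_ge0 => w _.
  by rewrite lee_fin subr_ge0 expR_le1 oppr_le0.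
rewrite -(cvg_lim _ lhs)// -(cvg_lim _ rhs)//; apply: congr_lim; apply/funext => n.
have [rg rgE] := (finite_seqP (range (g n))).1 (fimfunP (g n)).
have mem_rg r : (r \in rg) <-> range (g n) r by rewrite rgE.
pose a := undup [seq r <- rg | r != 0].
apply: (@laplace_finite_range _ a) => //.
- exact: undup_uniq.
- move=> r; rewrite mem_undup mem_filter lt_neqAle eq_sym => /andP[-> ] /=.
  by move=> /mem_rg[x _ <-].
- move=> x hx; rewrite mem_undup mem_filter hx/=.
  move: hx; rewrite /h indicE; case: (x \in F n).
    by rewrite mulr1 => _; apply/mem_rg; exists x.
  by rewrite mulr0 eqxx.
- apply: le_lt_trans (Foo n).2; apply: le_measure; rewrite ?inE//.
    rewrite (_ : mkset _ = ~` (h n @^-1` [set 0])); last first.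
      by apply/seteqP; split => x /= /eqP.
    apply: measurableC; rewrite -[X in measurable X]setTI; exact: mh.
  move=> x /=; rewrite /h indicE; case: (boolP (x \in F n)) => [/set_mem//|_].
  by rewrite mulr0 eqxx.
Qed.

End laplace_functional.

(** * Markov property of the excursion law *)

Section path_measurability.
Context {R : realType}.
Local Notation RR := (measurableTypeR R).

Lemma Dpast_coord (s t : R) (B : set RR) : 0 <= s <= t -> measurable B ->
  Dpast t (Dcoord s @^-1` B).
Proof.
move=> st mB; apply: sub_sigma_algebra; exists s; first by rewrite /= in_itv.
by exists B => //; rewrite setTI.
Qed.

Lemma measurable_Dcoord (s : R) : 0 <= s -> measurable_fun setT (Dcoord s).
Proof.
move=> s0 _ B mB; rewrite setTI; apply: sub_sigma_algebra.
by exists s; [rewrite /= in_itv/= s0|exists B => //; rewrite setTI].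
Qed.

Lemma Dpast_mono (s t : R) : s <= t -> Dpast s `<=` Dpast t.
Proof.
move=> st; apply: smallest_sub; first exact: smallest_sigma_algebra.
move=> _ [u us [B mB <-]]; apply: sub_sigma_algebra; exists u; last by exists B.
by move: us; rewrite /= !in_itv/= => /andP[-> /le_trans]; exact.
Qed.

Lemma Dpast_measurable (t : R) : Dpast t `<=` measurable.
Proof.
apply: smallest_sub; first exact: smallest_sigma_algebra.
move=> _ [u us [B mB <-]]; apply: sub_sigma_algebra; exists u; last by exists B.
by move: us; rewrite /= !in_itv/= => /andP[-> _].
Qed.

Lemma D1_absorbed (w : Dpath R) (s t : R) : D1 w -> 0 < s -> s <= t ->
  w s = 0 -> w t = 0.
Proof.
move=> [_ w0] s0 st ws; apply: w0; apply: (@le_trans _ _ s%:E); last by rewrite lee_fin.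
by apply: ereal_inf_lbound; exists s.
Qed.

End path_measurability.

Section excursion_chain.
Context {R : realType}.
Local Notation RR := (measurableTypeR R).
Variables (Q : R -> R.-pker RR ~> RR)
  (l : R -> {sigma_finite_measure set RR -> \bar R})
  (N0 : {measure set (Dpath R) -> \bar R}).

(** [Qo_chain] with a terminal function in place of 1, so that the innermost integral can be
    absorbed into that function. *)
Fixpoint Qo_chain_fun (t : nat -> R) (B : nat -> set RR) (f : RR -> \bar R)
    (n i : nat) (x : R) : \bar R :=
  if n is n'.+1 then
    (\int[Qo Q (t i.+1 - t i)%R x]_(y in B i.+1) Qo_chain_fun t B f n' i.+1 y)%E
  else f x.

Lemma Qo_chain_fun1 t B n i x : Qo_chain_fun t B (cst 1%E) n i x = Qo_chain Q t B n i x.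
Proof.
elim: n i x => [//|n ih] i x /=.
by apply: eq_integral => y _; exact: ih.
Qed.

(** The recursion unfolds at the first time, but the Markov property acts at the last one. *)
Lemma Qo_chain_fun_snoc t B f n i x :
  Qo_chain_fun t B f n.+1 i x =
  Qo_chain_fun t B (fun x =>
    \int[Qo Q (t (i + n).+1 - t (i + n)%N)%R x]_(y in B (i + n).+1) f y)%E n i x.
Proof.
elim: n i x => [|n ih] i x; first by rewrite /= addn0.
rewrite [LHS]/=; rewrite [RHS]/=; apply: eq_integral => y _.
have := ih i.+1 y; rewrite [LHS]/= => ->.
by rewrite addSnnS.
Qed.

Lemma eq_Qo_chain_fun t B B' f n i x :
  (forall j, (i < j <= i + n)%N -> B j = B' j) ->
  Qo_chain_fun t B f n i x = Qo_chain_fun t B' f n i x.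
Proof.
elim: n i x => [//|n ih] i x BB' /=.
rewrite BB'; last by rewrite ltnSn addnS ltnS leq_addr.
apply: eq_integral => y _; apply: ih => j /andP[ij jn].
by apply: BB'; rewrite (ltnW ij) addnS -addSn.
Qed.

Hypothesis fdd : forall (n : nat) (t : nat -> R) (B : nat -> set RR),
  0 < t 0%N -> (forall i, (i < n)%N -> t i < t i.+1) ->
  (forall i, (i <= n)%N -> measurable (B i) /\ B i `<=` `]0, +oo[) ->
  N0 [set w : Dpath R | forall i, (i <= n)%N -> B i (w (t i))] =
  (\int[l (t 0%N)]_(x in B 0%N) Qo_chain Q t B n 0%N x)%E.

Let cyl n (t : nat -> R) (B : nat -> set RR) : set (Dpath R) :=
  [set w | forall i, (i <= n)%N -> B i (w (t i))].

Let increasing n (t : nat -> R) :=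
  0 < t 0%N /\ forall i, (i < n)%N -> t i < t i.+1.

Let admissible n (B : nat -> set RR) :=
  forall i, (i <= n)%N -> measurable (B i) /\ B i `<=` `]0, +oo[.

Let increasing_gt0 n t i : increasing n t -> (i <= n)%N -> 0 < t i.
Proof.
move=> [t0 ti]; elim: i => [//|i ih] i_n.
by apply: lt_trans (ih (ltnW i_n)) _; exact: ti.
Qed.

Let measurable_cyl n t B : increasing n t -> admissible n B -> measurable (cyl n t B).
Proof.
move=> tn Bn; rewrite (_ : cyl n t B =
    \bigcap_(i in `I_n.+1) [set w : Dpath R | B i (w (t i))]); last first.
  by apply/seteqP; split => w wB i; exact: wB.
apply: fin_bigcap_measurable; first exact: finite_II.
move=> i /= i_n; rewrite -[X in measurable X]setTI.
apply: measurable_Dcoord => //; [exact/ltW/(increasing_gt0 tn)|by case: (Bn i i_n)].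
Qed.

Let cylS n t B : cyl n.+1 t B = cyl n t B `&` Dcoord (t n.+1) @^-1` B n.+1.
Proof.
apply/seteqP; split => [w wB|w [wB wBn] i]; first by split => [i /leqW|]; exact: wB.
by rewrite leq_eqVlt => /predU1P[->//|]; exact: wB.
Qed.

Let eq_cyl n t B B' : (forall i, (i <= n)%N -> B i = B' i) -> cyl n t B = cyl n t B'.
Proof. by move=> BB'; apply/seteqP; split => w wB i i_n; move: (wB i i_n); rewrite BB'. Qed.

Let measurable_Qo (q : R) C : measurable C ->
  measurable_fun setT (fun x : RR => Qo Q q x C).
Proof.
by move=> mC; apply: measurable_kernel; exact: measurableI.
Qed.

Let integral_Qo_ge0 q B (f : RR -> \bar R) x : (forall y, (0 <= f y)%E) ->
  (0 <= \int[Qo Q q x]_(y in B) f y)%E.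
Proof. by move=> f0; exact: integral_ge0. Qed.

Let measurable_integral_Qo q B (f : RR -> \bar R) : measurable B ->
  (forall y, (0 <= f y)%E) -> measurable_fun setT f ->
  measurable_fun setT (fun x : RR => \int[Qo Q q x]_(y in B) f y)%E.
Proof.
move=> mB f0 mf; under eq_fun do rewrite integral_mkcond.
apply: (@measurable_fun_integral_kernel _ _ RR RR R (Qo Q q)).
- by move=> U mU; exact: measurable_Qo.
- by move=> y; exact: erestrict_ge0.
- by apply/(measurable_restrictT _ mB); exact: measurable_funTS.
Qed.

Let chain_formula n t B (f : RR -> \bar R) := increasing n t -> admissible n B ->
  (forall y, (0 <= f y)%E) -> measurable_fun setT f ->
  (\int[N0]_w ((\1_(cyl n t B) w)%:E * f (w (t n))) =
   \int[l (t 0%N)]_(x in B 0%N) Qo_chain_fun t B f n 0%N x)%E.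

(** Both sides integrate [f] over [B n.+1], against the measures [nu1] and [nu2]. These agree on
    every measurable [C] inside [B n.+1], by [fdd] with [C] as the last set; since the agreement is
    set by set, the infinite mass of [N0] does no harm. *)
Let chain_step n t B (f : RR -> \bar R) :
  (forall f, chain_formula n t B f) -> increasing n.+1 t -> admissible n.+1 B ->
  (forall y, (0 <= f y)%E) -> measurable_fun setT f ->
  (\int[N0]_w ((\1_(cyl n t B) w)%:E * (f \_ (B n.+1)) (w (t n.+1))) =
   \int[N0]_w ((\1_(cyl n t B) w)%:E *
     \int[Qo Q (t n.+1 - t n) (w (t n))]_(y in B n.+1) f y))%E.
Proof.
move=> chain tn1 Bn1 f0 mf.
have tn : increasing n t by case: tn1 => ? h; split => // i i_n; exact/h/ltnW.
have Bn : admissible n B by move=> i i_n; exact/Bn1/leqW.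
have [mB Bpos] := Bn1 n.+1 (leqnn _).
have tn0 : 0 <= t n by exact/ltW/(increasing_gt0 tn).
have tn10 : 0 <= t n.+1 by exact/ltW/(increasing_gt0 tn1).
have mA := measurable_cyl tn Bn.
have mD : measurable_fun setT (\1_(cyl n t B) : Dpath R -> R).
  exact: measurable_indic.
have D0 w : 0 <= (\1_(cyl n t B) : Dpath R -> R) w by [].
have [nu1 [nu1B nu1f]] := weighted_law N0 D0 mD (measurable_Dcoord tn10).
have [|nu2 [nu2B nu2f]] := @mixture_measure _ _ _ _ _ N0 _
    (fun w : Dpath R => Qo Q (t n.+1 - t n) (w (t n))) D0 mD.
  move=> C mC; apply: (measurableT_comp (measurable_Qo _ mC)).
  exact: measurable_Dcoord.
have nuE C : measurable C -> C `<=` B n.+1 -> nu1 C = nu2 C.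
  move=> mC CB; rewrite nu1B nu2B.
  pose B' i := if i == n.+1 then C else B i.
  have B'n1 : B' n.+1 = C by rewrite /B' eqxx.
  have B'n i : (i <= n)%N -> B' i = B i by move=> i_n; rewrite /B' ltn_eqF.
  have aB' : admissible n.+1 B'.
    move=> i; rewrite leq_eqVlt => /predU1P[->|i_n].
      by rewrite B'n1; split => //; exact: subset_trans CB Bpos.
    by rewrite B'n//; exact: Bn.
  transitivity (N0 (cyl n.+1 t B')).
    have mC' := measurable_cyl tn1 aB'.
    rewrite -[X in _ = N0 X]setIT -integral_indic//.
    by apply: eq_integral => w _; rewrite cylS B'n1 (eq_cyl _ B'n) indicI.
  rewrite fdd//; [|by case: tn1|by case: tn1].
  rewrite B'n//.
  transitivity (\int[l (t 0%N)]_(x in B 0%N)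
      Qo_chain_fun t B (fun x => Qo Q (t n.+1 - t n) x C) n 0%N x)%E.
    apply: eq_integral => x _.
    rewrite -Qo_chain_fun1 Qo_chain_fun_snoc add0n B'n1 (@eq_Qo_chain_fun _ _ B).
      congr (Qo_chain_fun _ _ _ _ _ _); apply/funext => y.
      by rewrite integral_cst// mul1e.
    by move=> j /andP[_ jn]; exact: B'n.
  by rewrite -chain//; exact: measurable_Qo.
have := @eq_measure_integral _ _ _ (B n.+1) nu2 nu1 f nuE.
rewrite [in LHS]integral_mkcond nu1f; first last.
- by apply/(measurable_restrictT _ mB); exact: measurable_funTS.
- by move=> y; exact: erestrict_ge0.
move=> ->; rewrite integral_mkcond nu2f; first last.
- by apply/(measurable_restrictT _ mB); exact: measurable_funTS.
- by move=> y; exact: erestrict_ge0.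
by apply: eq_integral => w _; rewrite [in RHS]integral_mkcond.
Qed.

Let chainP n t B (f : RR -> \bar R) : chain_formula n t B f.
Proof.
elim: n f => [|n ih] f tn Bn f0 mf.
  have [t00 _] := tn; have [mB _] := Bn 0%N isT.
  have [nu [nuB nuf]] := @weighted_law _ _ _ _ R N0 (fun=> 1) (Dcoord (t 0%N))
    (fun=> ler01) (measurable_cst _) (measurable_Dcoord (ltW t00)).
  have nuE C : measurable C -> C `<=` B 0%N -> nu C = l (t 0%N) C.
    move=> mC CB.
    have N0C : N0 (cyl 0 t (fun=> C)) = l (t 0%N) C.
      apply: etrans (@fdd 0%N t (fun=> C) t00 _ _) _ => //.
        by move=> i _; split => //; apply: subset_trans CB _; case: (Bn 0%N isT).
      by rewrite /= integral_cst// mul1e.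
    have cylE : cyl 0 t (fun=> C) = Dcoord (t 0%N) @^-1` C.
      by apply/seteqP; split => [w /(_ 0%N isT)//|w wC [|//]].
    rewrite -N0C nuB; under eq_integral do rewrite mul1r.
    rewrite cylE -[X in _ = N0 X]setIT -integral_indic//.
    rewrite -[X in measurable X]setTI.
    by apply: measurable_Dcoord => //; exact: ltW.
  have := @eq_measure_integral _ _ _ (B 0%N) _ _ f nuE.
  rewrite [in LHS]integral_mkcond nuf; first last.
  - by apply/(measurable_restrictT _ mB); exact: measurable_funTS.
  - by move=> y; exact: erestrict_ge0.
  move=> <-; apply: eq_integral => w _; rewrite mul1e -indicM1E.
  rewrite (_ : cyl 0 t B = Dcoord (t 0%N) @^-1` B 0%N)//.
  by apply/seteqP; split => [w' /(_ 0%N isT)//|w' wC [|//]].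
transitivity (\int[N0]_w ((\1_(cyl n t B) w)%:E * (f \_ (B n.+1)) (w (t n.+1))))%E.
  by apply: eq_integral => w _; rewrite cylS indicI -indicM1E muleA EFinM.
have tn' : increasing n t by case: tn => ? h; split => // i i_n; exact/h/ltnW.
have Bn' : admissible n B by move=> i i_n; exact/Bn/leqW.
have [mB _] := Bn n.+1 (leqnn _).
rewrite (chain_step ih tn Bn f0 mf).
apply: etrans (ih (fun x => \int[Qo Q (t n.+1 - t n) x]_(y in B n.+1) f y)%E tn' Bn' _ _) _.
- by move=> y; exact: integral_Qo_ge0.
- exact: measurable_integral_Qo.
by apply: eq_integral => x _; rewrite Qo_chain_fun_snoc add0n.
Qed.

(** The condition [f 0 = 0] hides the paths that sit at 0 at time [t n.+1], which [fdd] does not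
    see, and on (0, oo) the measures [Qo] and [Q] coincide. *)
Lemma excursion_chain_markov n (t : nat -> R) (B : nat -> set RR) (f : RR -> \bar R) :
  0 < t 0%N -> (forall i, (i < n.+1)%N -> t i < t i.+1) ->
  (forall i, (i <= n)%N -> measurable (B i) /\ B i `<=` `]0, +oo[) ->
  (forall y, (0 <= f y)%E) -> measurable_fun setT f -> f 0 = 0%E ->
  (\int[N0]_w ((\1_[set w : Dpath R | forall i, (i <= n)%N -> B i (w (t i))] w)%:E *
     f (w (t n.+1))) =
   \int[N0]_w ((\1_[set w : Dpath R | forall i, (i <= n)%N -> B i (w (t i))] w)%:E *
     \int[Q (t n.+1 - t n) (w (t n))]_(y in `]0%R, +oo[) f y))%E.
Proof.
move=> t0 tn Bn f0 mf f00.
pose B' i := if i == n.+1 then `]0%R, +oo[%classic else B i.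
have B'n1 : B' n.+1 = `]0, +oo[%classic by rewrite /B' eqxx.
have B'n i : (i <= n)%N -> B i = B' i by move=> i_n; rewrite /B' ltn_eqF.
have aB' : admissible n.+1 B'.
  move=> i; rewrite leq_eqVlt => /predU1P[->|i_n]; last by rewrite -B'n//; exact: Bn.
  by rewrite B'n1; split => //; exact: measurable_itv.
have tn1 : increasing n.+1 t by [].
have := @chain_step n t B' f (fun f => @chainP n t B' f) tn1 aB' f0 mf.
rewrite -(eq_cyl _ B'n) B'n1 => E.
transitivity (\int[N0]_w ((\1_(cyl n t B) w)%:E * (f \_ `]0%R, +oo[) (w (t n.+1))))%E.
  apply: eq_integral => w _; congr *%E; rewrite patchE.
  case: ifPn => //; rewrite notin_setE/= in_itv/= andbT => /negP; rewrite -leNgt => w0.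
  suff -> : w (t n.+1) = 0 by rewrite f00.
  apply/eqP; rewrite eq_le w0/=.
  exact/Dpath_ge0/ltW/(increasing_gt0 tn1).
rewrite E; apply: eq_integral => w _; congr *%E.
apply: eq_measure_integral => A mA A0.
by rewrite /Qo/= /mrestr setIidl.
Qed.

Lemma excursion_entrance (s : R) (f : RR -> \bar R) : 0 < s ->
  (forall y, (0 <= f y)%E) -> measurable_fun setT f -> f 0 = 0%E ->
  (\int[N0]_w f (w s) = \int[l s]_(x in `]0%R, +oo[) f x)%E.
Proof.
move=> s0 f0 mf f00.
have incr : increasing 0 (fun=> s) by [].
have ad : admissible 0 (fun=> `]0, +oo[%classic).
  by move=> i _; split => //; exact: measurable_itv.
rewrite -(chainP incr ad f0 mf); apply: eq_integral => w _.
have := Dpath_ge0 w (ltW s0); rewrite le_eqVlt => /predU1P[ws|ws].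
  by rewrite -ws f00 mule0.
by rewrite indicE mem_set ?mul1e// => i _; rewrite /= in_itv/= ws.
Qed.

End excursion_chain.

Section excursion_markov.
Context {R : realType}.
Local Notation RR := (measurableTypeR R).
Variables (v : R -> R -> R) (Q : R -> R.-pker RR ~> RR)
  (l : R -> {sigma_finite_measure set RR -> \bar R})
  (N0 : {measure set (Dpath R) -> \bar R}).
Hypotheses (hQ : is_transition_semigroup v Q) (hl : is_entrance_family v l)
  (N0D1 : N0.-negligible (~` D1 (R:=R))).
Hypothesis fdd : forall (n : nat) (t : nat -> R) (B : nat -> set RR),
  0 < t 0%N -> (forall i, (i < n)%N -> t i < t i.+1) ->
  (forall i, (i <= n)%N -> measurable (B i) /\ B i `<=` `]0, +oo[) ->
  N0 [set w : Dpath R | forall i, (i <= n)%N -> B i (w (t i))] =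
  (\int[l (t 0%N)]_(x in B 0%N) Qo_chain Q t B n 0%N x)%E.

(** The absolute value makes [f] nonnegative on the whole line, as the chain formulas ask; states
    and path values are nonnegative, where it has no effect. *)
Let f (lambda : R) (y : RR) : \bar R := (1 - expR (- (lambda * `|y|)))%:E.

Let f_ge0 lambda y : 0 <= lambda -> (0 <= f lambda y)%E.
Proof. by move=> l0; rewrite lee_fin subr_ge0 expR_le1 oppr_le0 mulr_ge0. Qed.

Let f0 lambda : f lambda 0 = 0%E.
Proof. by rewrite /f normr0 mulr0 oppr0 expR0 subrr. Qed.

Let measurable_f lambda : measurable_fun setT (f lambda).
Proof.
apply/measurable_EFinP; apply: measurable_funB => //.
apply: measurableT_comp => //; apply: measurable_funN.
by apply: measurable_funM => //; exact: normr_measurable.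
Qed.

Let itv0E (m : {measure set RR -> \bar R}) (g : RR -> \bar R) : g 0 = 0%E ->
  (\int[m]_(y in `]0%R, +oo[) g y = \int[m]_(y in `[0%R, +oo[) g y)%E.
Proof.
move=> g0; rewrite integral_mkcond [RHS]integral_mkcond; apply: eq_integral => y _.
rewrite !patchE !mem_setE !in_itv/= !andbT le_eqVlt.
by case: eqVneq => [<-|]//=; rewrite ltxx.
Qed.

(** [Q q x] is a probability carried by [0, oo), so the integral is 1 minus the Laplace transform;
    the integrand vanishes at 0, whence the open half-line. *)
Lemma transition_laplace q x lambda : 0 <= q -> 0 <= x -> 0 <= lambda ->
  (\int[Q q x]_(y in `]0%R, +oo[) f lambda y = (1 - expR (- (x * v q lambda)))%:E)%E.
Proof.
move=> q0 x0 l0; have [Qneg Qlap] := hQ q0 x0; have := Qlap _ l0.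
have mI : measurable (`[0, +oo[%classic : set RR) by exact: measurable_itv.
rewrite itv0E; last exact: f0.
set a := (\int[_]_(y in _) _)%E => aE.
set b := (\int[_]_(y in _) _)%E.
have ab : (b + a = 1)%E.
  have mE : measurable_fun (`[0%R, +oo[%classic : set RR)
      (fun y : RR => (expR (- (lambda * y)))%:E).
    apply/measurable_EFinP; apply: measurable_funTS; apply: measurableT_comp => //.
    by apply: measurable_funN; exact: measurable_funM.
  have mf : measurable_fun (`[0%R, +oo[%classic : set RR) (f lambda) by exact: measurable_funTS.
  rewrite /a /b -(ge0_integralD _ mI (fun y _ => f_ge0 y l0) mf _ mE).
  - rewrite (eq_integral (cst 1%E)); last first.
    move=> y; rewrite inE/= in_itv/= andbT => y0.
    by rewrite /f ger0_norm// -EFinD subrK.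
    rewrite integral_cst// mul1e -(@prob_kernel _ _ _ _ _ (Q q) x).
    have negE : ~` (`[0%R, +oo[%classic : set RR) = [set y : R | y < 0].
      by apply/seteqP; split => y; rewrite /= in_itv/= andbT ltNge => /negP.
    rewrite -(setvU (`[0%R, +oo[%classic : set RR)) measureU//.
    + by rewrite negE -[LHS]add0e; congr (_ + _)%E; exact: esym Qneg.
    + exact: measurableC.
    + by rewrite setICl.
  - by move=> y _; rewrite lee_fin expR_ge0.
have : (b = (b + a) - a)%E by rewrite addeK// aE.
by rewrite ab aE => ->.
Qed.

Lemma excursion_laplace s lambda : 0 < s -> 0 <= lambda ->
  (\int[N0]_w (1 - expR (- (lambda * w s)))%:E = (v s lambda)%:E)%E.
Proof.
move=> s0 l0; transitivity (\int[N0]_w f lambda (w s))%E.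
  by apply: eq_integral => w _; rewrite /f ger0_norm// Dpath_ge0// ltW.
rewrite (excursion_entrance fdd s0 _ (measurable_f lambda) (f0 lambda)); last first.
  by move=> y; exact: f_ge0.
have [_ hls] := hl s0; rewrite (hls _ l0).
apply: eq_integral => y; rewrite inE/= in_itv/= andbT => y0.
by rewrite /f gtr0_norm.
Qed.

Section at_times.
Variables (r q lambda : R).
Hypotheses (r0 : 0 < r) (q0 : 0 < q) (l0 : 0 <= lambda) (vq0 : 0 <= v q lambda).

(** The section shows that [phi2] acts as the conditional [N0]-expectation of [phi1] given A_r. *)
Let phi1 (w : Dpath R) : R := 1 - expR (- (lambda * w (r + q))).
Let phi2 (w : Dpath R) : R := 1 - expR (- (v q lambda * w r)).

Let rq0 : 0 < r + q. Proof. exact: addr_gt0. Qed.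

Let phi1_ge0 w : 0 <= phi1 w.
Proof. by rewrite subr_ge0 expR_le1 oppr_le0 mulr_ge0// Dpath_ge0// ltW. Qed.

Let phi2_ge0 w : 0 <= phi2 w.
Proof. by rewrite subr_ge0 expR_le1 oppr_le0 mulr_ge0// Dpath_ge0// ltW. Qed.

Let measurable_phi1 : measurable_fun setT phi1.
Proof.
apply: measurable_funB => //; apply: measurableT_comp => //; apply: measurable_funN.
apply: measurable_funM; first exact: measurable_cst.
exact: (measurable_Dcoord (ltW rq0)).
Qed.

Let measurable_phi2 : measurable_fun setT phi2.
Proof.
apply: measurable_funB => //; apply: measurableT_comp => //; apply: measurable_funN.
apply: measurable_funM; first exact: measurable_cst.
exact: (measurable_Dcoord (ltW r0)).
Qed.

(** The time [r] is always appended, so that the last kernel of the chain leads from [r] to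
    [r + q]. *)
Let rectangle (u : seq R) (F : R -> set RR) : set (Dpath R) :=
  [set w | forall s, s \in rcons u r -> F s (w s) /\ 0 < w s].

Let markov_rectangle u F : (forall s, measurable (F s)) ->
    {in u, forall s, 0 < s < r} -> sorted <%R u ->
  (\int[N0]_w (phi1 w * \1_(rectangle u F) w)%:E =
   \int[N0]_w (phi2 w * \1_(rectangle u F) w)%:E)%E.
Proof.
(* The default value of [nth] is [r + q]: the sequence [t] runs through [u], equals [r] at index [n]
   and [r + q] at index [n.+1]. *)
move=> mF ur us; pose t := nth (r + q) (rcons u r); pose n := size u.
pose B i : set RR := F (t i) `&` `]0, +oo[%classic.
have tn : t n = r by rewrite /t nth_rcons ltnn eqxx.
have tn1 : t n.+1 = r + q by rewrite /t nth_default// size_rcons.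
have tu i : (i <= n)%N -> t i \in rcons u r.
  by move=> i_n; apply: mem_nth; rewrite size_rcons.
have t_r i : (i < n)%N -> 0 < t i < r.
  by move=> i_n; rewrite /t nth_rcons i_n; apply: ur; exact: mem_nth.
have t0 : 0 < t 0%N.
  have [n0|n0] := posnP n; first by rewrite -n0 tn.
  by case/andP: (t_r _ n0).
have tS i : (i < n.+1)%N -> t i < t i.+1.
  rewrite ltnS leq_eqVlt => /predU1P[->|i_n]; first by rewrite tn tn1 ltrDl.
  have [i1n|] := ltnP i.+1 n.
    rewrite /t !nth_rcons i_n i1n.
    by apply: (sorted_ltn_nth lt_trans) => //; exact: ltnSn.
  rewrite leq_eqVlt ltnNge i_n orbF => /eqP i1n.
  by rewrite -i1n tn; case/andP: (t_r _ i_n).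
have aB i : (i <= n)%N -> measurable (B i) /\ B i `<=` `]0, +oo[.
  by move=> _; split; [apply: measurableI => //; exact: measurable_itv|exact: subIsetr].
have rectE : rectangle u F = [set w : Dpath R | forall i, (i <= n)%N -> B i (w (t i))].
  apply/seteqP; split => [w wF i i_n|w wB s su].
    by have [Fw w0] := wF _ (tu _ i_n); split => //; rewrite /= in_itv/= w0.
  have i_n : (index s (rcons u r) <= n)%N.
    by rewrite -ltnS -(size_rcons u r) index_mem.
  have := wB _ i_n; rewrite /B /t nth_index// => -[? ].
  by rewrite /= in_itv/= andbT.
have := excursion_chain_markov fdd t0 tS aB (fun y => f_ge0 y l0)
  (measurable_f lambda) (f0 lambda).
rewrite -rectE tn tn1 (_ : r + q - r = q); last by ring.
move=> E; transitivity (\int[N0]_w ((\1_(rectangle u F) w)%:E * f lambda (w (r + q)%R)))%E.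
  apply: eq_integral => w _; rewrite /f ger0_norm; last exact/Dpath_ge0/ltW.
  by rewrite mulrC EFinM.
rewrite E; apply: eq_integral => w _; rewrite mulrC EFinM; congr *%E.
rewrite transition_laplace//; first by rewrite (mulrC (w r)).
- exact: ltW.
- by rewrite Dpath_ge0// ltW.
Qed.

Let vanish (w : Dpath R) : D1 w -> w r = 0 -> phi1 w = 0 /\ phi2 w = 0.
Proof.
move=> wD wr; rewrite /phi1 /phi2 wr.
rewrite (D1_absorbed wD r0 _ wr) ?lerDl; last exact: ltW.
by rewrite !mulr0 oppr0 expR0 subrr.
Qed.

Let cylinder (s : seq R) (F : R -> set RR) : set (Dpath R) :=
  [set w | forall u, u \in s -> F u (w u)].

Let measurable_cylinder s F : {in s, forall u, 0 <= u} ->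
  (forall u, measurable (F u)) -> measurable (cylinder s F).
Proof.
move=> s0 mF; rewrite (_ : cylinder s F =
    \bigcap_(u in [set` s]) [set w : Dpath R | F u (w u)]).
  apply: fin_bigcap_measurable; first exact: finite_seq.
  move=> u us; rewrite -[X in measurable X]setTI.
  by apply: measurable_Dcoord => //; exact: s0.
by apply/seteqP; split => w wB u; exact: wB.
Qed.

Let ae_int_eq (phi : Dpath R -> R) (A A' : set (Dpath R)) :
  measurable_fun setT phi -> (forall w, 0 <= phi w) -> measurable A -> measurable A' ->
  (forall w, D1 w -> phi w * \1_A w = phi w * \1_A' w) ->
  (\int[N0]_w (phi w * \1_A w)%:E = \int[N0]_w (phi w * \1_A' w)%:E)%E.
Proof.
move=> mphi phi0 mA mA' AA'; apply: ge0_ae_eq_integral => //.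
- by apply/measurable_EFinP; exact: measurable_funM.
- by apply/measurable_EFinP; exact: measurable_funM.
- by move=> w _; rewrite lee_fin mulr_ge0.
- by move=> w _; rewrite lee_fin mulr_ge0.
- apply: negligibleS N0D1 => w /= nAA' wD; apply: nAA' => _; congr EFin; exact: AA'.
Qed.

(* A path of [D1] that is positive at time [r] is positive on [(0, r]], and
   [phi1], [phi2] vanish on the other paths of [D1]: up to a null set the
   cylinder may be replaced by a rectangle of positive values, the only kind
   for which the finite-dimensional laws are prescribed. *)
Let markov_cylinder s F : {in s, forall u, 0 <= u <= r} ->
    (forall u, measurable (F u)) ->
  (\int[N0]_w (phi1 w * \1_(cylinder s F) w)%:E =
   \int[N0]_w (phi2 w * \1_(cylinder s F) w)%:E)%E.
Proof.
move=> sr mF; have s0 : {in s, forall u, 0 <= u} by move=> u /sr/andP[].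
have mC := measurable_cylinder s0 mF.
(* The formula [fdd] covers positive times only. Paths of [D1] start at 0, so a constraint at time 0
   either holds for all of them or for none. *)
have [F0|F0] := pselect (0 \in s -> F 0 0); last first.
  have C0 w : D1 w -> \1_(cylinder s F) w = 0 :> R.
    move=> [w0 _]; rewrite indicE memNset// => wF; apply: F0 => s0'.
    by have := wF _ s0'; rewrite w0.
  rewrite (ae_int_eq measurable_phi1 phi1_ge0 mC measurable0); last first.
    by move=> w wD; rewrite C0// indic0.
  rewrite (ae_int_eq measurable_phi2 phi2_ge0 mC measurable0); last first.
    by move=> w wD; rewrite C0// indic0.
  by apply: eq_integral => w _; rewrite indic0 !mulr0.
pose u := sort <=%R (undup [seq x <- s | 0 < x < r]).
have uE x : (x \in u) = (0 < x < r) && (x \in s).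
  by rewrite mem_sort mem_undup mem_filter.
(* [F'] is trivial off [s] because the rectangle always involves [r], which need not belong to
   [s]. *)
pose F' x := if x \in s then F x else setT.
have mF' x : measurable (F' x) by rewrite /F'; case: ifP.
have usorted : sorted <%R u by rewrite sort_lt_sorted undup_uniq.
have ur : {in u, forall x, 0 < x < r} by move=> x; rewrite uE => /andP[].
have mR : measurable (rectangle u F').
  rewrite (_ : rectangle u F' = cylinder (rcons u r) (fun x => F' x `&` `]0, +oo[%classic)).
    apply: measurable_cylinder => [x|x].
      by rewrite mem_rcons inE => /predU1P[->|/ur/andP[/ltW]//]; exact: ltW.
    by apply: measurableI => //; exact: measurable_itv.
  apply/seteqP; split => w wF x /wF; rewrite /= in_itv/= andbT.
    by case.
  by case.
have rectE w : D1 w -> w r != 0 -> \1_(cylinder s F) w = \1_(rectangle u F') w :> R.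
  move=> wD wr0; rewrite !indicE; congr (_%:R); congr nat_of_bool.
  apply/idP/idP => /set_mem H; apply/mem_set.
    move=> x; rewrite mem_rcons inE => xu.
    have x0r : 0 < x <= r.
      case/predU1P: xu => [->|/ur/andP[-> /ltW]//]; by rewrite r0/=.
    case/andP: x0r => x0 xr; split.
      by rewrite /F'; case: ifP => // /H.
    rewrite lt_neqAle Dpath_ge0 ?(ltW x0)// andbT eq_sym.
    by apply: contra wr0 => /eqP wx; apply/eqP; exact: (D1_absorbed wD x0 xr).
  move=> x xs; have /andP[x0 xr] := sr _ xs.
  have [x0'|x0'] := eqVneq x 0.
    by rewrite x0' (_ : w 0 = 0); [apply: F0; rewrite -x0'|case: wD].
  have xu : x \in rcons u r.
    have xpos : 0 < x by rewrite lt_neqAle eq_sym x0' x0.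
    by rewrite mem_rcons inE uE xs andbT xpos/= lt_neqAle xr andbT; case: eqVneq.
  by have [] := H _ xu; rewrite /F' xs.
have rect_eq (phi : Dpath R -> R) w : (forall w : Dpath R, D1 w -> w r = 0 -> phi w = 0) ->
    D1 w -> phi w * \1_(cylinder s F) w = phi w * \1_(rectangle u F') w.
  move=> phi_van wD; have [wr|wr] := eqVneq (w r) 0; last by rewrite rectE.
  by rewrite phi_van// !mul0r.
rewrite (ae_int_eq measurable_phi1 phi1_ge0 mC mR); last first.
  by move=> w wD; apply: rect_eq => // w' w'D /(vanish w'D)[].
rewrite (ae_int_eq measurable_phi2 phi2_ge0 mC mR); last first.
  by move=> w wD; apply: rect_eq => // w' w'D /(vanish w'D)[].
exact: markov_rectangle.
Qed.

Lemma excursion_markov_pos A : Dpast r A ->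
  (\int[N0]_w (phi1 w * \1_A w)%:E = \int[N0]_w (phi2 w * \1_A w)%:E)%E.
Proof.
move=> rA.
have [nu1 [nu1B _]] := weighted_law N0 phi1_ge0 measurable_phi1 (@measurable_id _ _ setT).
have [nu2 [nu2B _]] := weighted_law N0 phi2_ge0 measurable_phi2 (@measurable_id _ _ setT).
rewrite -[LHS]nu1B -[RHS]nu2B.
pose G := [set A | exists s F, [/\ {in s, forall u, 0 <= u <= r},
  forall u, measurable (F u) & A = cylinder s F]].
have nuG B : G B -> nu1 B = nu2 B.
  by move=> [s [F [sr mF ->]]]; rewrite nu1B nu2B; exact: markov_cylinder.
have GT : G setT.
  by exists [::], (fun=> setT); split => //; apply/seteqP; split => w.
apply: (@finite_measure_unique _ _ _ G nu1 nu2) => //.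
- move=> _ [s [F [sr mF ->]]]; apply: measurable_cylinder => //.
  by move=> u /sr/andP[].
- move=> _ _ [s [F [sr mF ->]]] [s' [F' [sr' mF' ->]]].
  exists (s ++ s'), (fun u => (if u \in s then F u else setT) `&`
                         (if u \in s' then F' u else setT)); split.
  + by move=> u; rewrite mem_cat => /orP[/sr|/sr'].
  + by move=> u; apply: measurableI; case: ifP.
  + apply/seteqP; split => [w [wF wF'] u|w wFF']; last first.
      by split => u us; have := wFF' u; rewrite mem_cat us ?orbT => /(_ isT)[].
    by rewrite mem_cat; split; case: ifP => //; [exact: wF|exact: wF'].
- exact: nuG.
- rewrite nu1B (_ : (\int[N0]_w _)%E = (v (r + q) lambda)%:E) ?ltry//.
  rewrite -excursion_laplace//; apply: eq_integral => w _.
  by rewrite indicT mulr1.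
- move: A rA; apply: smallest_sub; first exact: smallest_sigma_algebra.
  move=> _ [u ur [B mB <-]]; apply: sub_sigma_algebra; exists [:: u], (fun=> B); split => //.
    by move=> x; rewrite inE => /eqP ->; move: ur; rewrite /= in_itv.
  apply/seteqP; split => [w [_ wB] x|w wB]; first by rewrite inE => /eqP ->.
  by split => //; apply: wB; rewrite inE.
Qed.

End at_times.

End excursion_markov.

(** * Laws determined by moments and by Laplace transforms at the integers *)

Section transform_uniqueness.
Context {R : realType}.
Local Notation RR := (measurableTypeR R).

(** The images under [U] of the two weighted measures live on [0, 1]; the moment of order 0
    transfers finiteness from [W1] to [W2]. *)
Lemma weighted_moment_unique d (T : measurableType d) (m : {measure set T -> \bar R})
    (W1 W2 : T -> R) (U : T -> RR) :
    (forall x, 0 <= W1 x) -> (forall x, 0 <= W2 x) ->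
    measurable_fun setT W1 -> measurable_fun setT W2 -> measurable_fun setT U ->
    (forall x, 0 <= U x <= 1) -> (\int[m]_x (W1 x)%:E < +oo)%E ->
    (forall n, \int[m]_x (W1 x * U x ^+ n)%:E = \int[m]_x (W2 x * U x ^+ n)%:E)%E ->
  forall C, measurable C ->
    (\int[m]_x (W1 x * \1_C (U x))%:E = \int[m]_x (W2 x * \1_C (U x))%:E)%E.
Proof.
move=> W10 W20 mW1 mW2 mU U01 W1oo moment C mC.
have [nu1 [nu1B nu1f]] := weighted_law m W10 mW1 mU.
have [nu2 [nu2B nu2f]] := weighted_law m W20 mW2 mU.
rewrite -nu1B -nu2B.
have mI01 : measurable (`[0%R, 1%R]%classic : set RR) by exact: measurable_itv.
have UI x : (`[0%R, 1%R]%classic : set RR) (U x) by rewrite /= in_itv/=.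
have W2oo : (\int[m]_x (W2 x)%:E < +oo)%E.
  rewrite (_ : (\int[m]_x _)%E = (\int[m]_x (W1 x)%:E)%E)//.
  have := moment 0; under eq_integral do rewrite expr0 mulr1.
  by under [in X in _ = X -> _]eq_integral do rewrite expr0 mulr1.
have mom (nu : {measure set RR -> \bar R}) (W : T -> R) n :
    (forall f : RR -> \bar R, (forall y, (0 <= f y)%E) -> measurable_fun setT f ->
       (\int[nu]_y f y = \int[m]_x ((W x)%:E * f (U x)))%E) ->
    (\int[nu]_(y in `[0%R, 1%R]) (y ^+ n)%:E = \int[m]_x (W x * U x ^+ n)%:E)%E.
  move=> nuf; rewrite [LHS]integral_mkcond nuf.
  - apply: eq_integral => x _; rewrite EFinM patchE mem_set//; exact: UI.
  - by apply: erestrict_ge0 => y; rewrite /= in_itv/= => /andP[y0 _];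
      rewrite lee_fin exprn_ge0.
  - apply/(measurable_restrictT _ mI01); apply: measurable_funTS.
    by apply/measurable_EFinP; exact: measurable_funX.
apply: hausdorff_moment => //.
- rewrite nu1B; apply: le_lt_trans W1oo; rewrite le_eqVlt; apply/orP; left; apply/eqP.
  by apply: eq_integral => x _; rewrite indicT mulr1.
- rewrite nu2B; apply: le_lt_trans W2oo; rewrite le_eqVlt; apply/orP; left; apply/eqP.
  by apply: eq_integral => x _; rewrite indicT mulr1.
- by move=> n; rewrite (mom _ _ _ nu1f) (mom _ _ _ nu2f).
- rewrite nu1B integral0_eq// => x _.
  by rewrite indicE memNset ?mulr0// => /(_ (UI x)).
- rewrite nu2B integral0_eq// => x _.
  by rewrite indicE memNset ?mulr0// => /(_ (UI x)).
Qed.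

Lemma laplace_nat_unique (nu1 nu2 : {measure set RR -> \bar R}) :
    (nu1 setT < +oo)%E -> nu1 [set y | y < 0] = 0%E -> nu2 [set y | y < 0] = 0%E ->
    (forall n : nat, \int[nu1]_(y in `[0%R, +oo[) (expR (- (n%:R * y)))%:E =
                     \int[nu2]_(y in `[0%R, +oo[) (expR (- (n%:R * y)))%:E)%E ->
  forall B, measurable B -> nu1 B = nu2 B.
Proof.
move=> nu1oo nu1neg nu2neg lap B mB.
pose I : set RR := `[0%R, +oo[%classic.
have mI : measurable I by exact: measurable_itv.
have negE : ~` I = [set y : R | y < 0].
  by apply/seteqP; split => y; rewrite /I/= in_itv/= andbT ltNge => /negP.
have cap (nu : {measure set RR -> \bar R}) A : measurable A ->
    nu [set y | y < 0] = 0%E -> nu A = nu (A `&` I).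
  move=> mA nuI; rewrite -[A in LHS](setDUK (@subIsetl _ A I)) measureU//.
  - rewrite [X in (_ + X)%E](_ : _ = 0%E) ?adde0//.
    apply: (@subset_measure0 _ _ _ nu _ (~` I)) => //.
    + by apply: measurableD => //; exact: measurableI.
    + exact: measurableC.
    + by move=> x [Ax AIx] Ix; apply: AIx.
    + by rewrite negE.
  - exact: measurableI.
  - by apply: measurableD => //; exact: measurableI.
  - by rewrite setDIK.
(* The minimum keeps [U] in [0, 1] at negative reals too, where the weight [\1_I] is 0. *)
pose U (y : RR) : RR := Num.min 1 (expR (- y)).
have mU : measurable_fun setT U.
  apply: measurable_minr => //. exact: measurableT_comp.
have UE y : I y -> U y = expR (- y).
  by rewrite /I/= in_itv/= andbT => y0; rewrite /U min_r// expR_le1 oppr_le0.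
have U01 y : 0 <= U y <= 1 by rewrite /U le_min ler01 expR_ge0/= ge_min lexx.
have [ka1 [ka1B ka1f]] := weighted_law nu1
  (fun y => ler0n R (y \in I)) (@measurable_indic _ _ _ setT I mI) mU.
have [ka2 [ka2B ka2f]] := weighted_law nu2
  (fun y => ler0n R (y \in I)) (@measurable_indic _ _ _ setT I mI) mU.
have mI01 : measurable (`[0%R, 1%R]%classic : set RR) by exact: measurable_itv.
have UI y : (`[0%R, 1%R]%classic : set RR) (U y) by rewrite /= in_itv/=.
have mom (nu ka : {measure set RR -> \bar R}) n :
    (forall f : RR -> \bar R, (forall y, (0 <= f y)%E) -> measurable_fun setT f ->
       (\int[ka]_y f y = \int[nu]_x ((\1_I x)%:E * f (U x)))%E) ->
    (\int[ka]_(y in `[0%R, 1%R]) (y ^+ n)%:E =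
     \int[nu]_(y in I) (expR (- (n%:R * y)))%:E)%E.
  move=> kaf; rewrite [LHS]integral_mkcond kaf.
  - rewrite [RHS]integral_indicM; apply: eq_integral => x _; rewrite !indicE.
    case: (boolP (x \in I)) => [/set_mem xI|]; last by rewrite !mul0e.
    rewrite !mul1e patchE mem_set; last exact: UI.
    by rewrite UE// -mulrN expRM_natl.
  - by apply: erestrict_ge0 => y; rewrite /= in_itv/= => /andP[y0 _];
      rewrite lee_fin exprn_ge0.
  - apply/(measurable_restrictT _ mI01); apply: measurable_funTS.
    by apply/measurable_EFinP; exact: measurable_funX.
have nu2T : nu2 setT = nu1 setT.
  rewrite (cap nu1)// (cap nu2)// !setTI; have := lap 0%N.
  rewrite (eq_integral (cst 1%E)); last by move=> y _; rewrite mul0r oppr0 expR0.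
  rewrite [in X in _ = X -> _](eq_integral (cst 1%E)); last first.
    by move=> y _; rewrite mul0r oppr0 expR0.
  by rewrite !integral_cst// !mul1e.
have kaE : forall C, measurable C -> ka1 C = ka2 C.
  have kaoo (nu ka : {measure set RR -> \bar R}) : (nu setT < +oo)%E ->
    (forall C, ka C = \int[nu]_x (\1_I x * \1_C (U x))%:E)%E -> (ka setT < +oo)%E.
    move=> nuoo kaC; apply: le_lt_trans nuoo; rewrite kaC.
    rewrite (_ : (fun x => _) = (fun x => (\1_I x)%:E)); last first.
      by apply/funext => x; rewrite indicT mulr1.
    by rewrite integral_indic// setIT le_measure// inE.
  apply: hausdorff_moment => //.
  - exact: kaoo ka1B.
  - by apply: kaoo ka2B; rewrite nu2T.
  - by move=> n; rewrite (mom _ _ _ ka1f) (mom _ _ _ ka2f); exact: lap.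
  - rewrite ka1B integral0_eq// => x _.
    by rewrite [X in _ * X]indicE memNset ?mulr0// => /(_ (UI x)).
  - rewrite ka2B integral0_eq// => x _.
    by rewrite [X in _ * X]indicE memNset ?mulr0// => /(_ (UI x)).
(* On [I] the map - ln inverts [U], so [U y] lies in [C] exactly when [y] lies in [B]. *)
pose C : set RR := (fun u => - ln u) @^-1` B.
have mC : measurable C.
  have mg : measurable_fun setT (fun u : RR => - ln u).
    by apply: measurableT_comp => //; exact: measurable_ln.
  by rewrite -[X in measurable X]setTI; exact: mg.
have kaC (nu ka : {measure set RR -> \bar R}) :
    (forall C, ka C = \int[nu]_x (\1_I x * \1_C (U x))%:E)%E ->
    ka C = nu (B `&` I).
  have mBI : measurable (B `&` I) by exact: measurableI.
  move=> ->; rewrite -[X in _ = nu X]setIT -integral_indic//.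
  apply: eq_integral => x _; rewrite setIC indicI/=; congr EFin.
  rewrite !indicE; case: (boolP (x \in I)) => [/set_mem xI|]; last by rewrite !mul0r.
  congr (_ * (nat_of_bool _)%:R).
  have xE : - ln (U x) = x by rewrite UE// expRK opprK.
  by apply/idP/idP => /set_mem Cx; apply/mem_set; move: Cx; rewrite /C/= xE.
by rewrite (cap nu1)// (cap nu2)// -(kaC _ _ ka1B) -(kaC _ _ ka2B) kaE.
Qed.

End transform_uniqueness.

(** * The cumulant semigroup at small times and the total mass of the excursion law *)

Section cumulant.
Context {R : realType} (phi : R -> R) (v : R -> R -> R).
Hypothesis hv : is_cumulant_semigroup phi v.

Lemma cumulant_ge0 t lambda : 0 <= t -> 0 <= lambda -> 0 <= v t lambda.
Proof. by move=> t0 l0; have [] := hv l0 t0. Qed.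

Lemma cumulant0 lambda : 0 <= lambda -> v 0 lambda = lambda.
Proof.
move=> l0; have [_ _ ->] := hv l0 (lexx 0).
by rewrite set_itv1 Rintegral_set1 subr0.
Qed.

(** Integrability of [phi (v s lambda)] in [s] over [0, 1] makes the integral term vanish with
    [t]. *)
Lemma cvg_cumulant0 lambda : 0 <= lambda -> v t lambda @[t --> 0^'+] --> lambda.
Proof.
move=> l0; have [_ iphi _] := hv l0 ler01.
have phi0 := parameterized_integral_cvg_left ltr01 iphi.
apply: cvg_trans (_ : lambda - parameterized_integral lebesgue_measure 0 t
    (fun s => phi (v s lambda)) @[t --> 0^'+] --> lambda).
  apply: near_eq_cvg; near=> t; apply/esym.
  have t0 : 0 <= t by [].
  by have [_ _ ->] := hv l0 t0.
rewrite -[X in _ --> X]subr0; apply: cvgB; first exact: cvg_cst.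
exact: cvg_at_right_filter.
Unshelve. all: by end_near. Qed.

End cumulant.

Section excursion_mass.
Context {R : realType} (phi : R -> R).
Local Notation RR := (measurableTypeR R).
Variables (v : R -> R -> R) (N0 : {measure set (Dpath R) -> \bar R}).
Hypotheses (hv : is_cumulant_semigroup phi v)
  (lapN0 : forall s lambda, 0 < s -> 0 <= lambda ->
    (\int[N0]_w (1 - expR (- (lambda * w s)))%:E = (v s lambda)%:E)%E).

(** The integrand 1 - exp (- lambda w(s)) is at most 1, so the total mass is at least [v s lambda],
    which tends to [lambda] as [s] decreases to 0; and [lambda] is arbitrary. *)
Lemma excursion_mass : N0 setT = +oo%E.
Proof.
apply/eqyP => lambda l0.
have vN0 s : 0 < s -> ((v s lambda)%:E <= N0 setT)%E.
  move=> s0; rewrite -(lapN0 s0 (ltW l0)) -(mul1e (N0 setT)) -integral_cst//.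
  have w0 (w : Dpath R) : 0 <= lambda * w s by rewrite mulr_ge0 ?Dpath_ge0// ltW.
  apply: ge0_le_integral => //.
  - by move=> w _; rewrite lee_fin subr_ge0 expR_le1 oppr_le0.
  - apply/measurable_EFinP; apply: measurable_funB => //; apply: measurableT_comp => //.
    apply: measurable_funN; apply: measurable_funM; first exact: measurable_cst.
    exact: (measurable_Dcoord (ltW s0)).
  - by move=> w _; rewrite lee_fin gerBl expR_ge0.
have vl : (v t lambda)%:E @[t --> 0^'+] --> lambda%:E.
  exact: (cvg_comp _ _ (cvg_cumulant0 hv (ltW l0))).
rewrite -(cvg_lim _ vl)//; apply: lime_le; first by apply/cvg_ex; exists lambda%:E.
by near=> t; apply: vN0.
Unshelve. all: by end_near. Qed.

End excursion_mass.

(** The sets that do not separate [w] from [w'] form a sigma-algebra, and it contains the generators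
    of A_0, which depend on the starting point only. *)
Lemma Dpast0_at0 (R : realType) (A : set (Dpath R)) (w w' : Dpath R) :
  Dpast 0 A -> w 0 = w' 0 -> A w -> A w'.
Proof.
move=> A0 ww'; suff : A w <-> A w' by case.
move: A A0; pose H := [set A : set (Dpath R) | A w <-> A w'].
apply: (@smallest_sub _ _ _ H).
  split; first by [].
    by move=> A [AB BA]; split => -[_ NA]; split => //; [move=> /BA|move=> /AB].
  by move=> F HF; split => -[n _ Fn]; exists n => //; apply/(HF n).
move=> _ [s s0 [B mB <-]]; rewrite /H/=.
have -> : s = 0 by apply/eqP; move: s0; rewrite /= in_itv/= eq_le andbC.
by rewrite /Dcoord/= /preimage/= ww'.
Qed.

(** The coefficients are natural numbers because an integer multiple of a count [N A] in the
    exponent yields a power of exp (- N A), that is, a moment. *)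
Definition indic_sum (T : Type) (R : realType) (s : seq (set T * nat)) (x : T) : R :=
  \sum_(p <- s) p.2%:R * \1_(p.1) x.
Arguments indic_sum {T R} s x.

Section exp_indicator_sums.
Context d (T : measurableType d) (R : realType) (m : {measure set T -> \bar R}).

Lemma indic_sum_ge0 (s : seq (set T * nat)) x : 0 <= indic_sum s x :> R.
Proof. by apply: sumr_ge0 => p _; rewrite mulr_ge0. Qed.

Lemma measurable_indic_sum (s : seq (set T * nat)) :
  (forall p, p \in s -> measurable p.1) ->
  measurable_fun setT (indic_sum s : T -> R).
Proof.
elim: s => [_|p s ih ms].
  rewrite (_ : indic_sum _ = fun=> 0); first exact: measurable_cst.
  by apply/funext => x; rewrite /indic_sum big_nil.
rewrite (_ : indic_sum _ = (fun x => p.2%:R * \1_(p.1) x + indic_sum s x)).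
  apply: measurable_funD.
    apply: measurable_funM => //; apply: measurable_indic.
    by apply: ms; rewrite mem_head.
  by apply: ih => q qs; apply: ms; rewrite inE qs orbT.
by apply/funext => x; rewrite /indic_sum big_cons.
Qed.

(** Splitting a set [A] of the sigma-algebra along the first set of the sum makes the first
    exponential factor constant on both pieces. The claim is therefore proved for the integrals over
    every [A], by induction on the sum, and then taken at [setT]. *)
Lemma integral_expR_indic_sum (AA : set (set T)) (phi1 phi2 : T -> R) :
  sigma_algebra setT AA -> AA `<=` measurable ->
  (forall x, 0 <= phi1 x) -> (forall x, 0 <= phi2 x) ->
  measurable_fun setT phi1 -> measurable_fun setT phi2 ->
  (forall A, AA A -> \int[m]_x (phi1 x * \1_A x)%:E = \int[m]_x (phi2 x * \1_A x)%:E)%E ->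
  forall s, (forall p, p \in s -> AA p.1) ->
  (\int[m]_x (expR (- indic_sum s x) * phi1 x)%:E =
   \int[m]_x (expR (- indic_sum s x) * phi2 x)%:E)%E.
Proof.
move=> sAA mAA phi10 phi20 mphi1 mphi2 phi12 s sA.
have AAI A B : AA A -> AA B -> AA (A `&` B).
  rewrite -(sigma_algebra_id sAA).
  exact: (@measurableI _ (g_sigma_algebraType AA)).
have AAD A B : AA A -> AA B -> AA (A `\` B).
  move=> a b; rewrite setDE; apply: AAI => //.
  by case: sAA => _ + _ => /(_ B b); rewrite setTD.
have AAT : AA setT.
  by case: sAA => A0 + _ => /(_ set0 A0); rewrite setD0.
suff H A : AA A -> (\int[m]_x (phi1 x * \1_A x * expR (- indic_sum s x))%:E =
   \int[m]_x (phi2 x * \1_A x * expR (- indic_sum s x))%:E)%E.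
  have := H setT AAT; under eq_integral do rewrite indicT mulr1 mulrC.
  by under [in X in _ = X -> _]eq_integral do rewrite indicT mulr1 mulrC.
elim: s sA A => [_|p s ih sA] A aA.
  under eq_integral do rewrite /indic_sum big_nil oppr0 expR0 mulr1.
  by under [RHS]eq_integral do rewrite /indic_sum big_nil oppr0 expR0 mulr1; exact: phi12.
have pA : AA p.1 by apply: sA; rewrite mem_head.
have sA' q : q \in s -> AA q.1 by move=> qs; apply: sA; rewrite inE qs orbT.
have split_int (phi : T -> R) : (forall x, 0 <= phi x) -> measurable_fun setT phi ->
  (\int[m]_x (phi x * \1_A x * expR (- indic_sum (p :: s) x))%:E =
   (expR (- p.2%:R))%:E * \int[m]_x (phi x * \1_(A `&` p.1) x * expR (- indic_sum s x))%:E
   + \int[m]_x (phi x * \1_(A `\` p.1) x * expR (- indic_sum s x))%:E)%E.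
  move=> phi0 mphi.
  have mint B : AA B -> measurable_fun setT
      (fun x => (phi x * \1_B x * expR (- indic_sum s x))%:E).
    move=> /mAA mB; apply/measurable_EFinP; apply: measurable_funM.
      exact: measurable_funM.
    apply: measurableT_comp => //; apply: measurable_funN.
    by apply: measurable_indic_sum => q /sA'/mAA.
  have pint B x : setT x -> (0 <= (phi x * \1_B x * expR (- indic_sum s x))%:E)%E.
    by move=> _; rewrite lee_fin !mulr_ge0// expR_ge0.
  have k0 : (0 <= (expR (- p.2%:R) : R)%:E)%E by rewrite lee_fin expR_ge0.
  have m1 := mint _ (AAI _ _ aA pA); have m2 := mint _ (AAD _ _ aA pA).
  rewrite -(ge0_integralZl _ measurableT m1 (pint _) k0).
  rewrite -(ge0_integralD _ measurableT _ _ (pint _) m2); first last.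
  - exact: measurable_funeM.
  - by move=> x xT; rewrite mule_ge0// pint.
  apply: eq_integral => x _; rewrite -EFinM -EFinD; congr EFin.
  rewrite /indic_sum big_cons opprD expRD setDE !indicI indicC/=.
  rewrite !indicE; case: (x \in A); case: (x \in p.1);
    rewrite /= ?(mulr1, mulr0, mul0r, add0r, addr0, oppr0, expR0, mul1r)//.
  by rewrite mulrCA.
rewrite split_int// split_int// ih//; last exact: AAI.
by congr (_ + _)%E; apply: ih => //; exact: AAD.
Qed.

End exp_indicator_sums.

(** * The Poisson sum of excursions *)

Section poisson_sum.
Context {R : realType} (phi : R -> R).
Local Notation RR := (measurableTypeR R).
Variables (v : R -> R -> R) (Q : R -> R.-pker RR ~> RR)
  (l : R -> {sigma_finite_measure set RR -> \bar R})
  (N0 : {sigma_finite_measure set (Dpath R) -> \bar R}).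
Hypotheses (hv : is_cumulant_semigroup phi v) (hQ : is_transition_semigroup v Q)
  (hl : is_entrance_family v l) (N0D1 : N0.-negligible (~` D1 (R:=R))).
Hypothesis fdd : forall (n : nat) (t : nat -> R) (B : nat -> set RR),
  0 < t 0%N -> (forall i, (i < n)%N -> t i < t i.+1) ->
  (forall i, (i <= n)%N -> measurable (B i) /\ B i `<=` `]0, +oo[) ->
  N0 [set w : Dpath R | forall i, (i <= n)%N -> B i (w (t i))] =
  (\int[l (t 0%N)]_(x in B 0%N) Qo_chain Q t B n 0%N x)%E.
Context d (Omega : measurableType d) (P : probability Omega R) (z : R)
  (hz : 0 <= z) (N : R.-ker Omega ~> (Dpath R)).
Hypothesis hN : is_poisson_random_measure P N (mscale (NngNum hz) N0).

Local Notation X := (excursion_sum z N).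

Let weights (s : seq (set (Dpath R) * nat)) (o : Omega) : \bar R :=
  (\sum_(p <- s) p.2%:R%:E * N o p.1)%E.

Let sigma_finite_intensity : sigma_finite setT (mscale (NngNum hz) N0).
Proof.
have [F FT Foo] := sigma_finiteT N0; exists F => // i.
have [mF F_oo] := Foo i; split => //.
by rewrite /mscale/= lte_mul_pinfty ?lee_fin.
Qed.

Let past (r : R) (s : seq (set (Dpath R) * nat)) := forall p, p \in s -> Dpast r p.1.

Let past_measurable r s : past r s -> forall p, p \in s -> measurable p.1.
Proof. by move=> rs p /rs/Dpast_measurable. Qed.

Lemma excursion_sum_ge0 t o : (0 <= X t o)%E.
Proof.
rewrite /excursion_sum; case: ifPn => t0; last by rewrite lee_fin.
by apply: integral_ge0 => w _; rewrite lee_fin; exact/Dpath_ge0/ltW.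
Qed.

Let measurable_weights s : (forall p, p \in s -> measurable p.1) ->
  measurable_fun setT (weights s).
Proof.
elim: s => [_|p s ih ms].
  rewrite (_ : weights _ = fun=> 0%E); first exact: measurable_cst.
  by apply/funext => o; rewrite /weights big_nil.
rewrite (_ : weights _ = (fun o => p.2%:R%:E * N o p.1 + weights s o)%E).
  apply: emeasurable_funD.
    by apply: measurable_funeM; apply: measurable_kernel; apply: ms; rewrite mem_head.
  by apply: ih => q qs; apply: ms; rewrite inE qs orbT.
by apply/funext => o; rewrite /weights big_cons.
Qed.

Lemma measurable_excursion_sum t : measurable_fun setT (X t).
Proof.
have [t0|t0] := ltP 0 t; last first.
  rewrite (_ : X t = fun=> z%:E); first exact: measurable_cst.
  by apply/funext => o; rewrite /excursion_sum ltNge t0.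
rewrite (_ : X t = fun o => \int[N o]_w (Dcoord t w)%:E)%E; last first.
  by apply/funext => o; rewrite /excursion_sum t0.
have mt : measurable_fun setT (fun w : Dpath R => (Num.max 0 (w t))%:E).
  apply/measurable_EFinP; apply: measurable_maxr; first exact: measurable_cst.
  exact: (measurable_Dcoord (ltW t0)).
have := @measurable_fun_integral_kernel _ _ _ _ _ (fun o => N o)
   (measurable_kernel N) _ _ mt.
rewrite (_ : (fun o => _) = (fun o => \int[N o]_w (Dcoord t w)%:E)%E).
  by apply => w; rewrite lee_fin le_max lexx.
apply/funext => o; apply: eq_integral => w _.
by rewrite max_r//; exact/Dpath_ge0/ltW.
Qed.

Let integral_indic_sum s o : (forall p, p \in s -> measurable p.1) ->
  (\int[N o]_w (indic_sum s w)%:E = weights s o)%E.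
Proof.
elim: s => [_|p s ih ms].
  rewrite /weights big_nil; apply: integral0_eq => w _.
  by rewrite /indic_sum big_nil.
have mp : measurable p.1 by apply: ms; rewrite mem_head.
have ms' q : q \in s -> measurable q.1 by move=> qs; apply: ms; rewrite inE qs orbT.
rewrite /weights big_cons -[X in (_ + X)%E]ih//.
rewrite -[in RHS](setIT p.1) -integral_indic// -ge0_integralZl//; last first.
  exact/measurable_EFinP/measurable_indic.
rewrite -ge0_integralD//.
- apply: eq_integral => w _; rewrite -EFinM -EFinD; congr EFin.
  by rewrite /indic_sum big_cons.
- by apply: measurable_funeM; exact/measurable_EFinP/measurable_indic.
- by move=> w _; rewrite lee_fin indic_sum_ge0.
- by apply/measurable_EFinP; exact: measurable_indic_sum.
Qed.

Let laplace_weights s c t : (forall p, p \in s -> measurable p.1) -> 0 <= c -> 0 < t ->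
  (\int[P]_o (negexp (weights s o) * negexp (c%:E * X t o))%:E =
   (negexp (z%:E * \int[N0]_w (1 - expR (- indic_sum s w))%:E) *
    negexp (z%:E * \int[N0]_w (expR (- indic_sum s w) * (1 - expR (- (c * w t))))%:E))%:E)%E.
Proof.
move=> ms c0 t0.
have ct0 (w : Dpath R) : 0 <= c * w t by rewrite mulr_ge0// Dpath_ge0// ltW.
have mct : measurable_fun setT (fun w : Dpath R => c * w t).
  apply: measurable_funM; first exact: measurable_cst.
  exact: (measurable_Dcoord (ltW t0)).
have mis := measurable_indic_sum ms.
pose g (w : Dpath R) := indic_sum s w + c * w t.
have mg : measurable_fun setT g by exact: measurable_funD.
have g0 w : 0 <= g w by rewrite addr_ge0// indic_sum_ge0.
have := laplace_functional hN sigma_finite_intensity mg g0.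
rewrite ge0_integral_mscale//; last 2 first.
- apply/measurable_EFinP; apply: measurable_funB => //; apply: measurableT_comp => //.
  exact: measurable_funN.
- by move=> w _; rewrite lee_fin subr_ge0 expR_le1 oppr_le0.
rewrite /= => lap; transitivity (\int[P]_o (negexp (\int[N o]_w (g w)%:E))%:E)%E.
  apply: eq_integral => o _; rewrite -negexpD; congr (negexp _)%:E.
  rewrite -integral_indic_sum// /excursion_sum t0 -ge0_integralZl//; first last.
  - by move=> w _; rewrite lee_fin; exact/Dpath_ge0/ltW.
  - by apply/measurable_EFinP; exact: (measurable_Dcoord (ltW t0)).
  rewrite -ge0_integralD//.
  - by move=> w _; rewrite lee_fin indic_sum_ge0.
  - by apply/measurable_EFinP.
  - by move=> w _; rewrite -EFinM lee_fin ct0.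
  - by apply/measurable_EFinP.
have p1 (w : Dpath R) : (0 <= (1 - expR (- indic_sum s w))%:E)%E.
  by rewrite lee_fin subr_ge0 expR_le1 oppr_le0 indic_sum_ge0.
have p2 (w : Dpath R) : (0 <= (expR (- indic_sum s w) * (1 - expR (- (c * w t))))%:E)%E.
  by rewrite lee_fin mulr_ge0 ?expR_ge0// subr_ge0 expR_le1 oppr_le0.
rewrite lap -negexpD -ge0_muleDr; [|exact: integral_ge0|exact: integral_ge0].
congr (negexp (_ * _))%:E; rewrite -ge0_integralD//.
- apply: eq_integral => w _; rewrite -EFinD; congr EFin.
  by rewrite /g opprD expRD; ring.
- apply/measurable_EFinP; apply: measurable_funB => //; apply: measurableT_comp => //.
  exact: measurable_funN.
- apply/measurable_EFinP; apply: measurable_funM.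
    by apply: measurableT_comp => //; exact: measurable_funN.
  apply: measurable_funB => //; apply: measurableT_comp => //.
  exact: measurable_funN.
Qed.

(** Paths of [D1] start at 0 like the zero path, and sets of A_0 see nothing but the start. *)
Let ae_past0 s (w : Dpath R) : past 0 s -> D1 w ->
  indic_sum s w = indic_sum s (@zero_path R) :> R.
Proof.
move=> ps [w0 _]; rewrite /indic_sum !big_seq; apply: eq_bigr => p /ps p0.
congr (_ * _); rewrite !indicE; congr (nat_of_bool _)%:R.
by apply/idP/idP => /set_mem pw; apply/mem_set; apply: Dpast0_at0 pw => //; rewrite w0.
Qed.

Let integral_past0 s (f : R -> Dpath R -> R) : past 0 s ->
  (forall c w, 0 <= c -> 0 <= f c w) ->
  measurable_fun setT (fun w => f (indic_sum s w) w) ->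
  measurable_fun setT (f (indic_sum s (@zero_path R))) ->
  (\int[N0]_w (f (indic_sum s w) w)%:E =
   \int[N0]_w (f (indic_sum s (@zero_path R)) w)%:E)%E.
Proof.
move=> ps f0 mf mf0; apply: ge0_ae_eq_integral => //.
- exact/measurable_EFinP.
- exact/measurable_EFinP.
- by move=> w _; rewrite lee_fin f0// indic_sum_ge0.
- by move=> w _; rewrite lee_fin f0// indic_sum_ge0.
- apply: negligibleS N0D1 => w /= nw wD; apply: nw => _.
  by rewrite (ae_past0 ps wD).
Qed.

(* At [r = 0] the process starts from [z], not from the sum of the [w 0]: there
   [Dpast 0] is trivial up to null sets and the intensity is infinite, so that
   each [N A], [A] in [Dpast 0], is almost surely constant. *)
Lemma laplace_weights_markov r q lambda s : 0 <= r -> 0 <= q -> 0 <= lambda -> past r s ->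
  (\int[P]_o (negexp (weights s o) * negexp (lambda%:E * X (r + q)%R o))%:E =
   \int[P]_o (negexp (weights s o) * negexp ((v q lambda)%:E * X r o))%:E)%E.
Proof.
move=> r0 q0 l0 ps.
have [->|qN0] := eqVneq q 0; first by rewrite (cumulant0 hv l0) addr0.
have qpos : 0 < q by rewrite lt_neqAle eq_sym qN0.
have v0 := cumulant_ge0 hv q0 l0.
have ms := past_measurable ps.
have mis := measurable_indic_sum ms.
have [rE|rN0] := eqVneq r 0; last first.
  have rpos : 0 < r by rewrite lt_neqAle eq_sym rN0.
  have mw (c t : R) : 0 <= t -> measurable_fun setT (fun w : Dpath R => 1 - expR (- (c * w t))).
    move=> t0; apply: measurable_funB => //; apply: measurableT_comp => //.
    apply: measurable_funN; apply: measurable_funM; first exact: measurable_cst.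
    exact: (measurable_Dcoord t0).
  have pw (c t : R) (w : Dpath R) : 0 <= c -> 0 <= t -> 0 <= 1 - expR (- (c * w t)).
    by move=> c0 t0; rewrite subr_ge0 expR_le1 oppr_le0 mulr_ge0// Dpath_ge0.
  have rq0 : 0 < r + q by rewrite addr_gt0.
  rewrite (laplace_weights ms l0 rq0) (laplace_weights ms v0 rpos); congr (_ * negexp (_ * _))%:E.
  apply: (@integral_expR_indic_sum _ _ _ _ (Dpast r)).
  - exact: smallest_sigma_algebra.
  - exact: Dpast_measurable.
  - by move=> w; apply: pw => //; exact: ltW.
  - by move=> w; exact: pw.
  - by apply: mw; exact: ltW.
  - exact: mw.
  - by move=> A rA; exact: (excursion_markov_pos hQ hl N0D1 fdd rpos qpos l0 v0).
  - exact: ps.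
rewrite {}rE in ps *; rewrite add0r laplace_weights//.
pose c : R := indic_sum s (@zero_path R).
have c0 : 0 <= c by exact: indic_sum_ge0.
(* The coefficient 0, at the arbitrary time 1, isolates the transform of the counts. *)
have lap0 : (\int[P]_o (negexp (weights s o))%:E =
    (negexp (z%:E * \int[N0]_w (1 - expR (- indic_sum s w))%:E))%:E)%E.
  have := laplace_weights ms (lexx 0) ltr01.
  under eq_integral do rewrite mul0e negexp0 mulr1.
  have -> : (\int[N0]_w (expR (- indic_sum s w) * (1 - expR (- (0 * w 1))))%:E = 0)%E.
    by apply: integral0_eq => w _; rewrite mul0r oppr0 expR0 subrr mulr0.
  by move=> ->; rewrite mule0 negexp0 mulr1.
have -> : (\int[P]_o (negexp (weights s o) * negexp ((v q lambda)%:E * X 0 o))%:E =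
    (negexp (v q lambda * z)%:E)%:E * \int[P]_o (negexp (weights s o))%:E)%E.
  rewrite -ge0_integralZl//.
  - apply: eq_integral => o _; rewrite -EFinM mulrC; congr (_ * _)%:E.
    by rewrite /excursion_sum ltxx.
  - apply/measurable_EFinP; apply: measurableT_comp; first exact: measurable_negexp.
    exact: measurable_weights.
  - by move=> o _; rewrite lee_fin negexp_ge0.
  - by rewrite lee_fin negexp_ge0.
rewrite lap0 -EFinM mulrC.
(* For [z = 0] all exponents vanish. For positive [z] the a.e. value [c] of the indicator sum
   decides: if it is 0 the second exponent is [z * v q lambda]; otherwise the positive constant 1 -
   exp (- c) has infinite [N0]-integral and both sides are 0. *)
have [z0|zN0] := eqVneq z 0.
  by rewrite z0 !mul0e mulr0 !negexp0.
have zpos : 0 < z by rewrite lt_neqAle eq_sym zN0.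
have mq : measurable_fun setT (fun w : Dpath R => 1 - expR (- (lambda * w q))).
  apply: measurable_funB => //; apply: measurableT_comp => //.
  apply: measurable_funN; apply: measurable_funM; first exact: measurable_cst.
  exact: (measurable_Dcoord q0).
have [cE|cN0] := eqVneq c 0.
  congr (_ * _)%:E.
  rewrite (@integral_past0 s (fun c w => expR (- c) * (1 - expR (- (lambda * w q)))))//.
  - under eq_integral do rewrite -/c cE oppr0 expR0 mul1r.
    rewrite (excursion_laplace hl fdd qpos l0).
    by rewrite -EFinM mulrC.
  - move=> c' w c'0; rewrite mulr_ge0 ?expR_ge0// subr_ge0 expR_le1 oppr_le0.
    by rewrite mulr_ge0// Dpath_ge0.
  - apply: measurable_funM => //; apply: measurableT_comp => //; exact: measurable_funN.
  - by apply: measurable_funM => //; exact: measurable_cst.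
suff -> : (\int[N0]_w (1 - expR (- indic_sum s w))%:E = +oo)%E.
  by rewrite gt0_muley ?lte_fin//= ?mul0r ?mulr0.
rewrite (@integral_past0 s (fun c _ => 1 - expR (- c)))//.
- rewrite -/c integral_cst// (excursion_mass hv) ?gt0_muley ?lte_fin//.
    by rewrite subr_gt0 expR_lt1 oppr_lt0 lt_neqAle eq_sym cN0.
  by move=> t lambda' t0 l'0; exact: (excursion_laplace hl fdd).
- by move=> c' _ c'0; rewrite subr_ge0 expR_le1 oppr_le0.
- by apply: measurable_funB => //; apply: measurableT_comp => //; exact: measurable_funN.
Qed.

End poisson_sum.

(** * From transforms of the counts to the sigma-algebra that they generate *)

Section counting_events.
Context d d' (Omega : measurableType d) (E : measurableType d') (R : realType)
  (m : {measure set Omega -> \bar R}) (N : R.-ker Omega ~> E) (AA : set (set E)).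
Hypotheses (moo : (m setT < +oo)%E) (mAA : AA `<=` measurable).
Variables (e1 e2 : Omega -> R).
Hypotheses (e1_01 : forall o, 0 <= e1 o <= 1) (e2_01 : forall o, 0 <= e2 o <= 1)
  (me1 : measurable_fun setT e1) (me2 : measurable_fun setT e2).
Hypothesis e12 : forall s : seq (set E * nat), (forall p, p \in s -> AA p.1) ->
  (\int[m]_o (negexp (\sum_(p <- s) p.2%:R%:E * N o p.1) * e1 o)%:E =
   \int[m]_o (negexp (\sum_(p <- s) p.2%:R%:E * N o p.1) * e2 o)%:E)%E.

(** The value +oo at 0 lets it invert [negexp] on all of [0, +oo], so that infinite counts are
    recovered as well. *)
Let neglog (u : R) : \bar R := if 0 < u then (- ln u)%:E else +oo%E.

Let measurable_neglog : measurable_fun setT neglog.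
Proof.
apply: measurable_fun_if => //.
- exact: measurable_fun_ltr.
- by apply: measurable_funTS; apply/measurable_EFinP; exact: measurableT_comp.
Qed.

Let negexpK (y : \bar R) : (0 <= y)%E -> neglog (negexp y) = y.
Proof.
case: y => [r _|_|//]; rewrite /neglog/=; last by rewrite ltxx.
by rewrite expR_gt0 expRK opprK.
Qed.

Let W (s : seq (set E * set (\bar R))) (o : Omega) : R :=
  \prod_(p <- s) \1_(p.2) (N o p.1).

Let good (s : seq (set E * set (\bar R))) :=
  forall p, p \in s -> AA p.1 /\ measurable p.2.

Let W01 s o : 0 <= W s o <= 1.
Proof.
apply/andP; split; first by apply: prodr_ge0.
by apply: prodr_ile1 => p _; rewrite indicE; case: (_ \in _); rewrite ?lexx ?ler01.
Qed.

Let mN A : AA A -> measurable_fun setT (fun o => N o A).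
Proof. by move=> /mAA; exact: measurable_kernel. Qed.

Let mW s : good s -> measurable_fun setT (W s).
Proof.
move=> gs; apply: measurable_prod => p ps; have [Ap mp] := gs p ps.
apply: measurableT_comp; last exact: mN.
exact: measurable_indic.
Qed.

Let msum s : (forall p, p \in s -> AA p.1) ->
  measurable_fun setT (fun o => negexp (\sum_(p <- s) p.2%:R%:E * N o p.1)%E).
Proof.
move=> sA; apply: measurableT_comp; first exact: measurable_negexp.
elim: s sA => [_|p s ih sA].
  by under eq_fun do rewrite big_nil; exact: measurable_cst.
under eq_fun do rewrite big_cons; apply: emeasurable_funD.
  by apply: measurable_funeM; apply: mN; apply: sA; rewrite mem_head.
by apply: ih => q qs; apply: sA; rewrite inE qs orbT.
Qed.

(* Events [N A \in B] are introduced one at a time: the hypothesis with [(A, n)]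
   added to [s2] gives the [n]-th moment of [exp (- N A)], and moments on [[0, 1]]
   determine measures. *)
Let events_agree s1 s2 : good s1 -> (forall p, p \in s2 -> AA p.1) ->
  (\int[m]_o (W s1 o * (negexp (\sum_(p <- s2) p.2%:R%:E * N o p.1) * e1 o))%:E =
   \int[m]_o (W s1 o * (negexp (\sum_(p <- s2) p.2%:R%:E * N o p.1) * e2 o))%:E)%E.
Proof.
elim: s1 s2 => [s2 _ s2A|p s1 ih s2 gs s2A].
  under eq_integral do rewrite /W big_nil mul1r.
  by under [RHS]eq_integral do rewrite /W big_nil mul1r; exact: e12.
have [Ap mp] := gs p (mem_head _ _).
have gs1 : good s1 by move=> q qs; apply: gs; rewrite inE qs orbT.
pose U o := negexp (N o p.1).
have mU : measurable_fun setT U.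
  by apply: measurableT_comp; [exact: measurable_negexp|exact: mN].
have U01 o : 0 <= U o <= 1 by rewrite negexp_ge0 negexp_le1.
pose V (e : Omega -> R) o := W s1 o * (negexp (\sum_(p <- s2) p.2%:R%:E * N o p.1)%E * e o).
have sum0 s o : (0 <= \sum_(p <- s) p.2%:R%:E * N o p.1)%E.
  by apply: sume_ge0 => q _; rewrite mule_ge0.
have V01 e : (forall o, 0 <= e o <= 1) -> forall o, 0 <= V e o <= 1.
  move=> e01 o; have /andP[e0 e_1] := e01 o; have /andP[W0 W1] := W01 s1 o.
  rewrite mulr_ge0 ?mulr_ge0 ?negexp_ge0//=.
  by rewrite mulr_ile1 ?mulr_ge0 ?negexp_ge0// mulr_ile1 ?negexp_ge0// negexp_le1.
have mV e : measurable_fun setT e -> measurable_fun setT (V e).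
  move=> me; apply: measurable_funM; first exact: mW.
  by apply: measurable_funM => //; exact: msum.
have mC : measurable (neglog @^-1` p.2).
  by rewrite -[X in measurable X]setTI; exact: measurable_neglog.
have WE e o : W (p :: s1) o *
    (negexp (\sum_(p <- s2) p.2%:R%:E * N o p.1)%E * e o) =
    V e o * \1_(neglog @^-1` p.2) (U o).
  have -> : \1_(neglog @^-1` p.2) (U o) = \1_(p.2) (N o p.1) :> R.
    have NE : neglog (U o) = N o p.1 by exact: negexpK.
    rewrite !indicE; congr (nat_of_bool _)%:R.
    by apply/idP/idP => /set_mem H; apply/mem_set; move: H; rewrite /= NE.
  by rewrite /W big_cons -mulrA mulrC.
under eq_integral do rewrite WE.
under [RHS]eq_integral do rewrite WE.
apply: weighted_moment_unique => //.
- by move=> o; case/andP: (V01 _ e1_01 o).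
- by move=> o; case/andP: (V01 _ e2_01 o).
- exact: mV.
- exact: mV.
- apply: (@le_lt_trans _ _ (\int[m]_o 1)%E); last by rewrite integral_cst// mul1e.
  apply: ge0_le_integral => //.
  + by move=> o _; rewrite lee_fin; case/andP: (V01 _ e1_01 o).
  + by apply/measurable_EFinP; exact: mV.
  + by move=> o _; rewrite lee_fin; case/andP: (V01 _ e1_01 o).
- move=> n.
  have VE e o : V e o * U o ^+ n =
      W s1 o * (negexp (\sum_(q <- (p.1, n) :: s2) q.2%:R%:E * N o q.1)%E * e o).
    by rewrite big_cons negexpD negexp_natM//= /V /U; ring.
  under eq_integral do rewrite VE.
  under [RHS]eq_integral do rewrite VE.
  apply: ih => // q; rewrite inE => /predU1P[->//|]; exact: s2A.
Qed.

Lemma counting_events_agree F : sigma_generated AA (fun A o => N o A) F ->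
  (\int[m]_o (e1 o * \1_F o)%:E = \int[m]_o (e2 o * \1_F o)%:E)%E.
Proof.
move=> GF.
have e10 o : 0 <= e1 o by case/andP: (e1_01 o).
have e20 o : 0 <= e2 o by case/andP: (e2_01 o).
have [nu1 [nu1B _]] := weighted_law m e10 me1 (@measurable_id _ _ setT).
have [nu2 [nu2B _]] := weighted_law m e20 me2 (@measurable_id _ _ setT).
rewrite -[LHS]nu1B -[RHS]nu2B.
pose ev (s : seq (set E * set (\bar R))) : set Omega :=
  [set o | forall p, p \in s -> p.2 (N o p.1)].
have evW s o : \1_(ev s) o = W s o.
  rewrite indicE; case: (pselect (ev s o)) => [es|nes].
    rewrite mem_set// /W big_seq big1// => p /es pN.
    by rewrite indicE mem_set.
  rewrite memNset//; have /existsNP[p /not_implyP[ps pN]] := nes.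
  apply/esym/eqP; rewrite /W prodf_seq_eq0; apply/hasP; exists p => //=.
  by rewrite indicE memNset.
pose G := [set B | exists2 s, good s & B = ev s].
have nuG B : G B -> nu1 B = nu2 B.
  move=> [s gs ->]; rewrite nu1B nu2B.
  have := @events_agree s [::] gs (fun p => False_ind _ \o notF).
  under eq_integral do rewrite big_nil negexp0 mul1r mulrC -evW.
  by under [in X in _ = X -> _]eq_integral do rewrite big_nil negexp0 mul1r mulrC -evW.
have GT : G setT by exists [::] => //; apply/seteqP; split.
apply: (@finite_measure_unique _ _ _ G nu1 nu2) => //.
- move=> _ [s gs ->].
  rewrite (_ : ev s = \bigcap_(p in [set` s]) [set o | p.2 (N o p.1)]).
    apply: fin_bigcap_measurable; first exact: finite_seq.
    move=> p ps; have [Ap mp] := gs p ps.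
    by rewrite -[X in measurable X]setTI; exact: mN.
  by apply/seteqP; split => o oB p; exact: oB.
- move=> _ _ [s gs ->] [s' gs' ->]; exists (s ++ s').
    by move=> p; rewrite mem_cat => /orP[/gs|/gs'].
  apply/seteqP; split => [ o [os os'] p | o oss'].
    by rewrite mem_cat => /orP[/os|/os'].
  by split => p ps; apply: oss'; rewrite mem_cat ps ?orbT.
- exact: nuG.
- apply: le_lt_trans moo; rewrite nu1B -[leRHS]mul1e -integral_cst//.
  apply: ge0_le_integral => //.
  + by move=> o _; rewrite indicT mulr1 lee_fin.
  + by apply/measurable_EFinP; apply: measurable_funM.
  + by move=> o _; rewrite indicT mulr1 lee_fin; case/andP: (e1_01 o).
- move: F GF; apply: smallest_sub; first exact: smallest_sigma_algebra.
  move=> _ [A AAA [B mB <-]]; apply: sub_sigma_algebra; exists [:: (A, B)].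
    by move=> p; rewrite inE => /eqP ->.
  apply/seteqP; split => [ o [_ oB] p | o oB].
    by rewrite inE => /eqP ->.
  by split => //; apply: (oB (A, B)); rewrite inE.
Qed.

End counting_events.

(** * The sum over atoms, adaptedness, and small arguments of the cumulant *)

Section atomic_sum.
Context {R : realType} d (Omega : measurableType d) (N : R.-ker Omega ~> (Dpath R))
  (J : Omega -> set nat) (w : Omega -> nat -> Dpath R).
Hypothesis hNw : is_atomic_sum N J w.

Lemma excursion_sum_esum z t o : 0 < t ->
  excursion_sum z N t o = \esum_(i in J o) (w o i t)%:E.
Proof.
move=> t0; rewrite /excursion_sum t0.
have f0 (p : Dpath R) : (0 <= (Dcoord t p)%:E)%E.
  by rewrite lee_fin; exact/Dpath_ge0/ltW.
have mf : measurable_fun setT (fun p : Dpath R => (Dcoord t p)%:E).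
  by apply/measurable_EFinP; exact: (measurable_Dcoord (ltW t0)).
(* With the zero measure at indices off [J o], the random measure becomes a series of measures over
   all of [nat]. *)
pose m n : {measure set (Dpath R) -> \bar R} :=
  if n \in J o then (@dirac _ _ (w o n) R : {measure set (Dpath R) -> \bar R})
    else (mzero : {measure set (Dpath R) -> \bar R}).
have esumE (u : nat -> \bar R) : (forall i, (0 <= u i)%E) ->
    \esum_(i in J o) u i = (\sum_(i <oo) (if i \in J o then u i else 0))%E.
  move=> u0; rewrite -eseries_mkcond nneseries_esum//.
  by congr esum; apply/seteqP; split => i /=; [move/mem_set|move/set_mem].
rewrite (@eq_measure_integral _ _ _ setT (mseries m 0) (N o)); last first.
  move=> A mA _; rewrite hNw//= esumE// /mseries.
  by apply: eq_eseriesr => i _; rewrite /m; case: ifP.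
rewrite ge0_integral_measure_series// esumE; last first.
  by move=> i; exact: f0.
apply: eq_eseriesr => i _; rewrite /m; case: ifP => _.
  by rewrite integral_dirac// diracT mul1e.
by rewrite integral_measure_zero.
Qed.

End atomic_sum.

Section filtration.
Context {R : realType} d (Omega : measurableType d) (N : R.-ker Omega ~> (Dpath R)) (z : R).
Local Notation RR := (measurableTypeR R).

Lemma excursion_filtration_measurable t : excursion_filtration N t `<=` measurable.
Proof.
apply: smallest_sub; first exact: sigma_algebra_measurable.
move=> _ [A /Dpast_measurable mA [B mB <-]].
by apply: (measurable_kernel N) => //; exact: mA.
Qed.

Lemma is_filtration_excursion : is_filtration (excursion_filtration N).
Proof.
split=> [t t0|s t s0 st].
  by split; [exact: smallest_sigma_algebra|exact: excursion_filtration_measurable].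
apply: smallest_sub; first exact: smallest_sigma_algebra.
move=> _ [A sA [B mB <-]]; apply: sub_sigma_algebra.
by exists A; [exact: Dpast_mono sA|exists B].
Qed.

(** Relative to G_t the measure of a general path set need not be measurable in [o]. The image of
    [N o] under the coordinate at [t] is, because {w(t) in B} belongs to A_t; hence X_t is written
    as an integral against that image on the line. *)
Lemma excursion_sum_adapted t (B : set (\bar R)) : 0 <= t -> measurable B ->
  excursion_filtration N t (excursion_sum z N t @^-1` B).
Proof.
move=> t0 mB; pose T' := g_sigma_algebraType
  (sigma_generators (Dpast t) (fun A o => N o A)).
suff mX : @measurable_fun _ _ T' (\bar R) setT (excursion_sum z N t).
  by rewrite -[X in excursion_filtration _ _ X]setTI; exact: mX.
have [tpos|] := ltP 0 t; last first.
  move=> tle0; rewrite (_ : excursion_sum z N t = fun=> z%:E).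
    exact: measurable_cst.
  by apply/funext => o; rewrite /excursion_sum ltNge tle0.
have law o : exists nu : {measure set RR -> \bar R},
    (forall B, measurable B -> nu B = N o (Dcoord t @^-1` B)) /\
    excursion_sum z N t o = (\int[nu]_y (Num.max 0 y)%:E)%E.
  have [nu [nuB nuf]] := @weighted_law _ _ _ _ R (N o) (fun=> 1) (Dcoord t)
    (fun=> ler01) (measurable_cst _) (measurable_Dcoord t0).
  exists nu; split => [C mC|].
    have mDC : measurable (Dcoord t @^-1` C).
      by rewrite -[X in measurable X]setTI; exact: (measurable_Dcoord t0).
    rewrite nuB -[X in _ = N o X]setIT -integral_indic//.
    by apply: eq_integral => w _; rewrite mul1r.
  rewrite nuf; first last.
  - by apply/measurable_EFinP; apply: measurable_maxr.
  - by move=> y; rewrite lee_fin le_max lexx.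
  rewrite /excursion_sum tpos; apply: eq_integral => w _.
  by rewrite mul1e max_r//; exact: Dpath_ge0.
have [K KP] := choice law.
rewrite (_ : excursion_sum z N t = fun o => (\int[K o]_y (Num.max 0 y)%:E)%E); last first.
  by apply/funext => o; case: (KP o).
apply: (@measurable_fun_integral_kernel _ _ T' RR R K).
- move=> U mU; rewrite (_ : (fun o => _) = fun o => N o (Dcoord t @^-1` U)); last first.
    by apply/funext => o; case: (KP o) => ->.
  move=> _ C mC; apply: sub_sigma_algebra; exists (Dcoord t @^-1` U).
    by apply: Dpast_coord => //; rewrite t0 lexx.
  by exists C.
- by move=> y; rewrite lee_fin le_max lexx.
- by apply/measurable_EFinP; apply: measurable_maxr.
Qed.

End filtration.

(** Dominated convergence under [l t]: the bound 1 - exp (- u) has the finite integral [v t 1]. This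
    limit yields the almost sure finiteness of X_t. *)
Lemma cvg_cumulant_small (R : realType) (v : R -> R -> R)
    (l : R -> {sigma_finite_measure set (measurableTypeR R) -> \bar R}) (t : R) :
  is_entrance_family v l -> 0 < t -> v t n.+1%:R^-1 @[n --> \oo] --> 0.
Proof.
move=> hl t0; have [_ lE] := hl t t0.
pose I : set (measurableTypeR R) := `]0%R, +oo[%classic.
have mI : measurable I by exact: measurable_itv.
have mf (c : R) : measurable_fun I (fun u : measurableTypeR R => (1 - expR (- (c * u)))%:E).
  apply/measurable_EFinP; apply: measurable_funTS; apply: measurable_funB => //.
  apply: measurableT_comp => //; apply: measurable_funN.
  by apply: measurable_funM => //; exact: measurable_cst.
have pos (c u : R) : 0 <= c -> I u -> 0 <= 1 - expR (- (c * u)).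
  rewrite /I/= in_itv/= andbT => c0 u0.
  by rewrite subr_ge0 expR_le1 oppr_le0 mulr_ge0// ltW.
have cv : (\int[l t]_(u in I) (1 - expR (- (n.+1%:R^-1 * u)))%:E @[n --> \oo] -->
    \int[l t]_(u in I) (cst 0 u))%E.
  apply: (@dominated_cvg _ _ _ _ _ mI _ _ (fun u => (1 - expR (- (1 * u)))%:E)).
  - by move=> n; exact: mf.
  - move=> u Iu; rewrite /cst [X in _ --> X%:E](_ : _ = 1 - expR (- (0 * u))).
      apply: (@cvg_comp _ _ _ (fun n => 1 - expR (- (n.+1%:R^-1 * u))) EFin _
        (nbhs (1 - expR (- (0 * u))))) => //.
      apply: cvgB; first exact: cvg_cst.
      apply: continuous_cvg; first exact: continuous_expR.
      apply: cvgN; apply: cvgM; last exact: cvg_cst.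
      exact: cvg_harmonic.
    by rewrite mul0r oppr0 expR0 subrr.
  - by [].
  - apply/integrableP; split; first exact: mf.
    rewrite (eq_integral (fun u : measurableTypeR R => (1 - expR (- (1 * u)))%:E)); last first.
      by move=> u /set_mem Iu; rewrite gee0_abs// lee_fin pos.
    by rewrite -lE ?ltry.
  - move=> n u Iu; rewrite gee0_abs ?lee_fin ?pos// lerD2l lerN2 ler_expR lerN2.
    rewrite ler_wpM2r//; first by move: Iu; rewrite /I/= in_itv/= andbT => /ltW.
    by rewrite invf_le1// ler1n.
have -> : (fun n => v t n.+1%:R^-1) =
    fine \o (fun n => \int[l t]_(u in I) (1 - expR (- (n.+1%:R^-1 * u)))%:E)%E.
  by apply/funext => n /=; rewrite -lE.
by move: cv; rewrite integral0 => /fine_cvgP[].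
Qed.

Theorem theorem6p2 (R : realType) (phi : R -> R)
    (hphi : is_branching_mechanism phi)
    (hphi_inf : derive1 phi z @[z --> +oo] --> +oo)
    (N0 : {sigma_finite_measure set (Dpath R) -> \bar R})
    (hN0 : is_excursion_law phi N0)
    (d : measure_display) (Omega : measurableType d) (P : probability Omega R)
    (z : R) (hz : 0 <= z)
    (N : R.-ker Omega ~> (Dpath R))
    (hN : is_poisson_random_measure P N (mscale (NngNum hz) N0))
    (J : Omega -> set nat) (w : Omega -> nat -> Dpath R)
    (hNw : is_atomic_sum N J w) :
  [/\ forall (t : R) (o : Omega), 0 < t ->
        excursion_sum z N t o = \esum_(i in J o) (w o i t)%:E,
      forall t : R, 0 <= t ->
        {ae P, forall o, (excursion_sum z N t o < +oo)%E}
    & is_CB_process P phi (excursion_filtration N)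
        (fun t o => fine (excursion_sum z N t o))].
Proof.
have [v [Q [l [[hv hQ hl] [N0D1 _ fdd]]]]] := hN0.
have markov r q lambda s (r0 : 0 <= r) (q0 : 0 <= q) (l0 : 0 <= lambda) :=
  laplace_weights_markov hv hQ hl N0D1 fdd hN r0 q0 l0 (s := s).
pose X := excursion_sum z N.
have X0 t o : (0 <= X t o)%E by exact: excursion_sum_ge0.
have mX t : measurable_fun setT (X t) by exact: measurable_excursion_sum.
have me c t : measurable_fun setT (fun o => negexp (c%:E * X t o)%E).
  apply: measurableT_comp; first exact: measurable_negexp.
  exact: measurable_funeM.
have e01 c t o : 0 <= c -> 0 <= negexp (c%:E * X t o)%E <= 1.
  by move=> c0; rewrite negexp_ge0 negexp_le1// mule_ge0.
have aefin t : 0 <= t -> {ae P, forall o, (X t o < +oo)%E}.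
  rewrite le_eqVlt => /predU1P[<-|t0].
    by apply: aeW => o; rewrite /X /excursion_sum ltxx ltry.
  have lap c : 0 <= c ->
      (\int[P]_o (negexp (c%:E * X t o))%:E = (expR (- (v t c * z)))%:E)%E.
    (* With no counts and [r = 0], the Markov identity compares X_t with the constant X_0 = z. *)
    move=> c0; have := markov 0 t c [::] (lexx 0) (ltW t0) c0 (fun p => False_ind _ \o notF).
    under eq_integral do rewrite big_nil negexp0 mul1r add0r.
    move=> ->; under eq_integral do rewrite big_nil negexp0 mul1r /excursion_sum ltxx.
    rewrite integral_cst//; apply: etrans (mule1 _); congr *%E.
    exact: probability_setT.
  have mfin : measurable [set o | (X t o < +oo)%E].
    rewrite -[X in measurable X]setTI.
    exact: (emeasurable_fun_infty_o measurableT (mX t)).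
  (* Since [negexp] is 0 at +oo, exp (- X_t / (n+1)) is at most the indicator of finiteness of X_t;
     its expectation tends to 1 with [n]. *)
  have Plow n : ((expR (- (v t n.+1%:R^-1 * z)))%:E <= P [set o | (X t o < +oo)%E])%E.
    have n0 : 0 < n.+1%:R^-1 :> R by rewrite invr_gt0 ltr0n.
    rewrite -(lap _ (ltW n0)) -[X in (_ <= P X)%E]setIT -integral_indic//.
    apply: ge0_le_integral => //.
    - by move=> o _; rewrite lee_fin negexp_ge0.
    - by apply/measurable_EFinP; exact: me.
    - by apply/measurable_EFinP; exact: measurable_indic.
    - move=> o _; rewrite lee_fin indicE.
      have [Xoo|] := boolP (X t o < +oo)%E.
        by rewrite mem_set//; case/andP: (e01 _ t o (ltW n0)).
      rewrite ltey negbK => /eqP ->.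
      by rewrite gt0_muley ?lte_fin.
  have P1 : P [set o | (X t o < +oo)%E] = 1%E.
    apply/eqP; rewrite eq_le probability_le1//=.
    have cvR : expR (- (v t n.+1%:R^-1 * z)) @[n --> \oo] --> expR (- (0 * z)).
      apply: continuous_cvg; first exact: continuous_expR.
      apply: cvgN; apply: cvgM; last exact: cvg_cst.
      exact: (cvg_cumulant_small hl t0).
    rewrite mul0r oppr0 expR0 in cvR.
    have cv : (expR (- (v t n.+1%:R^-1 * z)))%:E @[n --> \oo] --> 1%:E.
      exact: (cvg_comp _ _ cvR).
    rewrite -(cvg_lim _ cv)//; apply: lime_le; first by apply/cvg_ex; exists 1%:E.
    exact: nearW.
  exists (~` [set o | (X t o < +oo)%E]); split.
  - exact: measurableC.
  - by rewrite probability_setC// P1 subee.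
  - by [].
split; [ by move=> t o t0; exact: excursion_sum_esum|exact: aefin|].
exists v, Q; split => //; split.
- exact: is_filtration_excursion.
- move=> t t0; split => [ o | B mB]; first exact: fine_ge0.
  have mfB : measurable (fine @^-1` B : set (\bar R)).
    by rewrite -[Y in measurable Y]setTI; exact: fine_measurable.
  exact: (excursion_sum_adapted z t0 mfB).
move=> r t B r0 t0 mB; split.
  move=> C mC.
  have mQC : measurable ((fun x : measurableTypeR R => Q t x B) @^-1` C).
    rewrite -[Y in measurable Y]setTI.
    by apply: (measurable_kernel (Q t) B mB).
  have mfB : measurable (fine @^-1` ((fun x => Q t x B) @^-1` C) : set (\bar R)).
    by rewrite -[Y in measurable Y]setTI; exact: fine_measurable.
  exact: (excursion_sum_adapted z r0 mfB).
move=> A rA.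
have mA : measurable A := excursion_filtration_measurable rA.
pose Y u (o : Omega) : measurableTypeR R := fine (X u o).
have mY u : measurable_fun setT (Y u) by exact: measurableT_comp (mX u).
have Y0 u o : 0 <= Y u o by exact: fine_ge0.
have D0 o : 0 <= (\1_A : Omega -> R) o by [].
have mD : measurable_fun setT (\1_A : Omega -> R) by exact: measurable_indic.
have rt0 : 0 <= r + t by exact: addr_ge0.
(* The measures [k1], giving P(A, X_(r+t) in C), and [k2], giving the integral over [A] of Q_t(X_r,
   C), are to be shown equal; both are carried by [0, oo), so their Laplace transforms at the
   integers are compared. *)
have [k1 [k1B k1f]] := weighted_law P D0 mD (mY (r + t)).
have [|k2 [k2B k2f]] := @mixture_measure _ _ _ _ _ P _ (fun o => Q t (Y r o)) D0 mD.
  move=> C mC; apply: (measurableT_comp (measurable_kernel (Q t) C mC)).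
  exact: mY.
have mYB : measurable (Y (r + t) @^-1` B).
  by rewrite -[Z in measurable Z]setTI; exact: mY.
transitivity (k2 B).
  by rewrite k2B [LHS]integral_indicM.
transitivity (k1 B); last first.
  have mAB : measurable (A `&` Y (r + t) @^-1` B) by exact: measurableI.
  rewrite k1B -[X in _ = P X]setIT -integral_indic//.
  by apply: eq_integral => o _; rewrite indicI.
apply/esym; apply: (laplace_nat_unique _ _ _ _ mB).
- rewrite k1B (@le_lt_trans _ _ (\int[P]_o 1)%E)//; last first.
    rewrite integral_cst// mul1e.
    exact: le_lt_trans (probability_le1 P measurableT) (ltry 1).
  apply: ge0_le_integral => //.
  + apply/measurable_EFinP; apply: measurable_funM => //.
    by rewrite indicT; exact: measurable_cst.
  + move=> o _; rewrite indicT mulr1 lee_fin indicE.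
    by case: (_ \in _); rewrite ?lexx ?ler01.
- rewrite k1B integral0_eq// => o _.
  by rewrite [X in _ * X]indicE memNset ?mulr0//= ltNge Y0.
- rewrite k2B integral0_eq// => o _.
  by have [-> _] := hQ t (Y r o) t0 (Y0 r o); rewrite mule0.
move=> n; have n0 : 0 <= n%:R :> R by [].
pose I : set (measurableTypeR R) := `[0%R, +oo[%classic.
have mI : measurable I by exact: measurable_itv.
have mf : measurable_fun setT (fun y : measurableTypeR R => (expR (- (n%:R * y)))%:E).
  apply/measurable_EFinP; apply: measurableT_comp => //; apply: measurable_funN.
  by apply: measurable_funM => //; exact: measurable_cst.
have f0 (y : measurableTypeR R) : (0 <= (expR (- (n%:R * y)))%:E)%E.
  by rewrite lee_fin expR_ge0.
have mfI := (measurable_restrictT _ mI).1 (measurable_funTS mf).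
have fI0 : forall y : measurableTypeR R,
    (0 <= ((fun y : measurableTypeR R => (expR (- (n%:R * y)))%:E) \_ I) y)%E.
  by move=> y; exact: erestrict_ge0.
rewrite integral_mkcond [RHS]integral_mkcond k1f// k2f//.
have vn0 := cumulant_ge0 hv t0 n0.
have events := @counting_events_agree _ _ _ _ _ P N (Dpast r) _ (@Dpast_measurable _ r)
  (fun o => negexp (n%:R%:E * X (r + t)%R o)%E)
  (fun o => negexp ((v t n%:R)%:E * X r o)%E)
  (fun o => e01 _ _ o n0) (fun o => e01 _ _ o vn0) (me _ _) (me _ _)
  (fun s => markov r t n%:R s r0 t0 n0) A rA.
(* [fine] sends +oo to 0, where the exponential is 1, while [negexp] is 0 at +oo; the two integrands
   therefore agree only up to the null set where the sum is infinite. *)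
have ae_negexp c u : 0 <= u -> (\int[P]_o (negexp (c%:E * X u o) * \1_A o)%:E =
    \int[P]_o (\1_A o * expR (- (c * Y u o)))%:E)%E.
  move=> u0; apply: ge0_ae_eq_integral.
  - exact: measurableT.
  - by apply/measurable_EFinP; exact: measurable_funM.
  - have mcY : measurable_fun setT (fun o => - (c * Y u o)).
      apply: measurable_funN; apply: measurable_funM; first exact: measurable_cst.
      exact: mY.
    apply/measurable_EFinP; apply: measurable_funM; first exact: mD.
    by apply: measurableT_comp mcY; exact: measurable_expR.
  - by move=> o _; rewrite lee_fin mulr_ge0 ?negexp_ge0.
  - by move=> o _; rewrite lee_fin mulr_ge0 ?expR_ge0.
  - apply: filterS (aefin u u0) => o Xoo _; rewrite mulrC; congr (_ * _)%:E.
    by rewrite /Y -[in LHS](@fineK _ (X u o)) ?ge0_fin_numE// -EFinM.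
transitivity (\int[P]_o (negexp (n%:R%:E * X (r + t)%R o) * \1_A o)%:E)%E.
  rewrite (ae_negexp _ _ rt0); apply: eq_integral => o _; rewrite EFinM; congr *%E.
  rewrite patchE mem_set; first by [].
  by rewrite /I/= in_itv/= Y0.
rewrite events; last first.
  exact: le_lt_trans (probability_le1 P measurableT) (ltry 1).
rewrite (ae_negexp _ _ r0); apply: eq_integral => o _; rewrite EFinM; congr *%E.
have [_ lapQ] := hQ t (Y r o) t0 (Y0 r o).
by rewrite -integral_mkcond (lapQ _ n0) mulrC.
Qed.
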